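(* There exist $C_1,C_2>0$ such that for all $t\in\mathbb{N}$ the following hold, where $T$ is sampled uniformly at random from all trees on vertex set $[t]$: for all integers $\ell\in[1,t]$ we have $\mathbb{E}[\mathrm{cov}_\ell(T)]\le \frac{C_1 t}{\ell}$, and for all integers $\ell\in[1,C_2\sqrt{t}]$ we have $\mathbb{E}[\mathrm{cov}_\ell(T)]\ge \frac{C_2 t}{\ell}$. Furthermore, there exists $c>0$ such that for all $t\in\mathbb{N}$, all integers $1\le \ell\le c\sqrt{t}$ and all $\delta\in(0,1)$, if $T$ is sampled uniformly at random from all trees on vertex set $[t]$, then $$\mathbb{P}_T\left(\left|\mathrm{cov}_\ell(T)-\mathbb{E}[\mathrm{cov}_\ell(T)]\right|>\frac{\delta t}{\ell}\right)\le \frac{c\,t^2}{\delta\, e^{c\delta^2 t/\ell^3}}.$$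
   Context: For a graph $G$ and integer $\ell$, $\mathrm{cov}_\ell(G)$ denotes the maximum number of vertices of $G$ that can be covered by a system of vertex-disjoint paths in $G$, each of length at least $\ell$ (length = number of edges). *)

(* Defs.v *)
From HB Require Import structures.
From mathcomp Require Import all_boot all_order all_algebra.
From mathcomp Require Import boolp reals.

Set Implicit Arguments.
Unset Strict Implicit.
Unset Printing Implicit Defensive.

Import Order.TTheory GRing.Theory Num.Theory.

Local Open Scope ring_scope.

(* A graph on the vertex set V is given by its edge set G : {set {set V}};
   [simple_graph] says that every edge is an unordered pair of distinct
   vertices, which makes [adj G] symmetric and irreflexive. *)
Definition simple_graph (V : finType) (G : {set {set V}}) : Prop :=
  forall e : {set V}, e \in G -> #|e| = 2%N.

Definition adj (V : finType) (G : {set {set V}}) : rel V :=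
  fun x y => [set x; y] \in G.

Definition connected_graph (V : finType) (G : {set {set V}}) : Prop :=
  (0 < #|V|)%N /\ forall x y : V, connect (adj G) x y.

Definition acyclic_graph (V : finType) (G : {set {set V}}) : Prop :=
  forall c : seq V, (3 <= size c)%N -> ~ (cycle (adj G) c && uniq c).

Definition is_tree (V : finType) (G : {set {set V}}) : Prop :=
  [/\ simple_graph G, connected_graph G & acyclic_graph G].

(* The vertex set [t] is represented by 'I_t. *)
Definition trees (t : nat) : {set {set {set 'I_t}}} :=
  [set G : {set {set 'I_t}} | `[< is_tree G >]].

(* Paths are listed by their successive vertices. *)
Definition is_path (V : finType) (G : {set {set V}}) (s : seq V) : bool :=
  [&& s != [::], sorted (adj G) s & uniq s].

Definition path_length (V : finType) (s : seq V) : nat := (size s).-1.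

Definition path_system (V : finType) (G : {set {set V}}) (l : nat)
    (ss : seq (seq V)) : bool :=
  all (fun s => is_path G s && (l <= path_length s)%N) ss
  && pairwise (fun s1 s2 : seq V => [disjoint s1 & s2]) ss.

Definition covered (V : finType) (ss : seq (seq V)) : {set V} :=
  [set v | v \in flatten ss].

Definition cov (V : finType) (l : nat) (G : {set {set V}}) : nat :=
  (\max_(S : {set V} |
      `[< exists ss : seq (seq V), path_system G l ss /\ S = covered ss >])
     #|S|)%N.

(* Expectation and probability for a uniformly random element of A. *)
Definition unif_expect (R : realType) (T : finType) (A : {set T})
    (f : T -> R) : R :=
  (\sum_(x in A) f x) / #|A|%:R.

Definition unif_prob (R : realType) (T : finType) (A : {set T})
    (E : pred T) : R :=
  #|[set x in A | E x]|%:R / #|A|%:R.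

Definition expect_cov (R : realType) (t l : nat) : R :=
  unif_expect (trees t) (fun T => (cov l T)%:R).

(* Main.v *)
Require Import Defs.
From HB Require Import structures.
From mathcomp Require Import all_boot all_order all_algebra perm zify ring lra.
From mathcomp Require Import boolp reals sequences exp.

Set Implicit Arguments.
Unset Strict Implicit.
Unset Printing Implicit Defensive.

(* The uniform tree is compared with a uniform function f : [t] -> [t].

   Expectation. Write N_k for the number of vertices above which a rooted forest
   has height at least k. In a tree, cov_l >= N_l (cut at depths of a fixed residue
   modulo l + 1), and cov_l <= C N_k + (contribution of a spine longer than 2k)
   with k about l / 8. A tree with two marked vertices is a forest whose roots,
   the spine, are linearly ordered, and a function is a forest whose roots, the
   cyclic points, are permuted; hence E N_k may be computed for f. Exploring the
   preimages of a point level by level is a Reed-Frost epidemic dominated by a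
   critical Poisson branching process, whence E N_k = O(t / k); a second moment
   argument gives the matching lower bound for k = O(sqrt t). The number S of
   cyclic points satisfies E S^2 <= 2 t.

   Concentration. Paths may be cut into pieces of at most 2 l + 1 vertices, so
   cov_l is O(l)-Lipschitz and certified by O(cov_l) values of f, and Talagrand's
   inequality bounds P(cov_l <= a) P(cov_l > b) for f. Rooted trees are a fraction
   1 / t of all functions, which costs a factor t^2 for the tree; the means give
   P(cov_l <= E cov_l + d), P(cov_l > E cov_l - d) >= d / (2 t). *)

(** * Functional graphs and rooted trees *)

(** The statistic N_k ([deep k]) ignores how the roots are arranged: it takes the same value on f
    and on [tie f], so it passes exactly between bipointed trees and functions, which cov_l does
    not. Paths running along the spine are paid for separately. A spine with S vertices is charged
    only if S >= 2 k, and then S <= S^2 / (2 k), so that E S^2 <= 2 t gives O(t / k). A first moment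
    would give only O(sqrt t), which suffices for l up to sqrt t but not for l up to t.

    In the concentration bound the same constant c limits l, multiplies the right-hand side B and
    sits in the exponent, so a large prefactor cannot be hidden in c. Since a probability P is at
    most 1, it suffices to prove P <= B^2: squaring turns the prefactor c t^2 into c^2 t^4 and only
    doubles the rate. A small c moreover forces t >= c^-2, because 1 <= l <= c sqrt t, and this
    absorbs the numerical constants and the factor l. *)

Section FunctionalGraph.

Variable V : finType.
Implicit Types (f g h : {ffun V -> V}) (x y z r : V) (G : {set {set V}}).

(** The search starts at f x because [fconnect] is reflexive: x must come back after at least one
    step. *)
Definition cyc f x := fconnect f (f x) x.

Definition upd f x y : {ffun V -> V} := [ffun z => if z == x then y else f z].

Definition fedges f : {set {set V}} :=
  [set [set x; f x] | x in [pred x | f x != x]].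

Lemma fconnect_step f x y : fconnect f x y = (x == y) || fconnect f (f x) y.
Proof.
apply/idP/orP => [|[/eqP->|]]; last 2 first.
- exact: connect0.
- exact: connect_trans (fconnect1 _ _).
move/iter_findex; case: (findex f x y) => [|n] /= <-; first by left.
by right; rewrite -iterS iterSr fconnect_iter.
Qed.

Lemma cyc_fconnect f x y : cyc f x -> fconnect f x y -> fconnect f y x.
Proof.
move=> cx /iter_findex <-; elim: (findex _ _ _) => [|n IHn] /=.
  exact: connect0.
by move: IHn; rewrite fconnect_step => /predU1P[->|].
Qed.

Lemma cyc_trans f x y : cyc f x -> fconnect f x y -> cyc f y.
Proof.
move=> cx xy; apply: (connect_trans _ xy); apply: (cyc_fconnect cx).
exact: connect_trans xy (fconnect1 _ _).
Qed.

Lemma cyc_iter f n x : cyc f x -> cyc f (iter n f x).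
Proof. by move=> cx; apply: cyc_trans cx (fconnect_iter _ _ _). Qed.

(** [order f] counts the points of the forward orbit and serves as the depth: off the cycles, x is
    the only point lost on passing to f x. *)
Lemma order_noncyc f x : ~~ cyc f x -> order f x = (order f (f x)).+1.
Proof.
move=> ncx; rewrite /order (cardD1 x) inE connect0 add1n; congr _.+1.
apply: eq_card => y; rewrite !inE fconnect_step.
by case: eqVneq => //= ->; apply/esym/negbTE.
Qed.

Lemma adj_fedges f x y :
  adj (fedges f) x y = (x != y) && ((f x == y) || (f y == x)).
Proof.
apply/imsetP/andP => [[z /=]|[xy /orP[/eqP fx|/eqP fy]]].
- rewrite inE => fz E.
  have := cards2 x y; rewrite E cards2 eq_sym fz => -[] /esym.
  case: eqVneq => // xy _.
  have : y \in [set z; f z] by rewrite -E set22.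
  have : x \in [set z; f z] by rewrite -E set21.
  by case/set2P=> Ex /set2P[] Ey; move: xy; rewrite Ex Ey ?eqxx ?orbT // => _.
- by exists x; rewrite ?inE fx // eq_sym.
- by exists y; rewrite ?inE fy // setUC.
Qed.


Lemma simple_fedges f : simple_graph (fedges f).
Proof. by move=> e /imsetP[x]; rewrite inE => fx ->; rewrite cards2 eq_sym fx. Qed.

Lemma adjC G x y : adj G x y = adj G y x.
Proof. by rewrite /adj setUC. Qed.

Lemma connect_fedges f x y : fconnect f x y -> connect (adj (fedges f)) x y.
Proof.
move/iter_findex <-; elim: (findex f x y) => [|n IHn] /=; first exact: connect0.
apply: connect_trans IHn _; set z := iter n f x.
case: (eqVneq z (f z)) => [<-|zfz]; first exact: connect0.
by apply: connect1; rewrite adj_fedges zfz eqxx.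
Qed.

Definition parent_fn r f := (f r == r) && [forall x, fconnect f x r].

Lemma parent_fn_root r f : parent_fn r f -> f r = r.
Proof. by case/andP=> /eqP. Qed.

Lemma parent_fn_connect r f x : parent_fn r f -> fconnect f x r.
Proof. by case/andP=> _ /forallP. Qed.

Lemma parent_fn_cyc r f x : parent_fn r f -> cyc f x = (x == r).
Proof.
move=> pf; apply/idP/eqP => [cx|->]; last by rewrite /cyc parent_fn_root ?connect0.
have /iter_findex <- := cyc_fconnect cx (parent_fn_connect x pf).
by elim: (findex f r x) => //= n ->; rewrite parent_fn_root.
Qed.

Lemma parent_fn_fixed r f x : parent_fn r f -> f x = x -> x = r.
Proof. by move=> pf fx; apply/eqP; rewrite -(parent_fn_cyc x pf) /cyc fx connect0. Qed.

Lemma cards_gt0_root r f : parent_fn r f -> (0 < #|V|)%N.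
Proof. by move=> _; apply/card_gt0P; exists r. Qed.

Lemma adj_fedges_order r f x y : parent_fn r f ->
  adj (fedges f) x y -> order f y <= order f x -> f x = y.
Proof.
move=> pf; rewrite adj_fedges => /andP[xy /orP[/eqP//|/eqP fy]].
have ncy : ~~ cyc f y.
  rewrite (parent_fn_cyc _ pf); apply: contraNneq xy => yr.
  by rewrite -fy yr (parent_fn_root pf).
by rewrite (order_noncyc ncy) fy ltnn.
Qed.

(** At a vertex of maximal depth on a cycle, both neighbours would be its parent, hence equal. *)
Lemma parent_fn_acyclic r f : parent_fn r f -> acyclic_graph (fedges f).
Proof.
move=> pf c c3 /andP[cc uc].
have [x0 x0c] : exists x0, x0 \in c.
  by case: c c3 {cc uc} => // x0 c; exists x0; rewrite mem_head.
case: (arg_maxnP (order f) (x0c : [in c] x0)) => x xc maxx.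
case: (rot_to xc) => i p rotc.
have max z : z \in x :: p -> order f z <= order f x.
  by rewrite -rotc mem_rot; apply: maxx.
have size_p : 1 < size p by rewrite -ltnS -[(size p).+1]/(size (x :: p)) -rotc size_rot.
have {cc} : cycle (adj (fedges f)) (x :: p) by rewrite -rotc rot_cycle.
have {uc} : uniq (x :: p) by rewrite -rotc rot_uniq.
case: p size_p max {rotc} => [|y p] //= p1 max /and3P[_ yp _].
rewrite rcons_path => /and3P[xy _ zx].
have fxy : f x = y by apply: adj_fedges_order pf xy (max _ _); rewrite !inE eqxx orbT.
have fxz : f x = last y p.
  by apply: adj_fedges_order pf _ (max _ _); rewrite ?(adjC _ x) // inE mem_last orbT.
by case: p yp fxz p1 {max zx} => //= z p yp fxz _; case/negP: yp;
  rewrite -fxy fxz mem_last.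
Qed.

Lemma connect_adj_sym G : connect_sym (adj G).
Proof. by apply: sym_connect_sym => x y; apply: adjC. Qed.

Lemma parent_fn_connected r f : parent_fn r f -> connected_graph (fedges f).
Proof.
move=> pf; split=> [|x y]; first exact: cards_gt0_root pf.
apply: connect_trans (connect_fedges (parent_fn_connect x pf)) _.
by rewrite connect_adj_sym; apply: connect_fedges (parent_fn_connect y pf).
Qed.

Lemma parent_fn_tree r f : parent_fn r f -> is_tree (fedges f).
Proof.
move=> pf; split; first exact: simple_fedges.
  exact: parent_fn_connected pf.
exact: parent_fn_acyclic pf.
Qed.

(* An edge outside a connected spanning subgraph closes a cycle. *)
Lemma acyclic_spanning G f : simple_graph G -> acyclic_graph G ->
  connected_graph (fedges f) -> fedges f \subset G -> fedges f = G.
Proof.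
move=> sG aG [_ cf] fG; apply/eqP; rewrite eqEsubset fG; apply/subsetP => e eG.
have /eqP/cards2P[x [y [xy E]]] := sG e eG; rewrite {}E in eG *.
have subadj : subrel (adj (fedges f)) (adj G) by move=> u v; apply: (subsetP fG).
have /connectP[p0 path0 lastp0] := cf x y.
case/shortenP: path0 lastp0 => p pth un _ lastp {p0}.
case: p pth un lastp => [|z [|w p]] /= pth un lastp.
- by rewrite lastp eqxx in xy.
- by move: pth; rewrite andbT -lastp.
case: (aG [:: x, z, w & p]) => //; apply/andP; split=> //=.
case/and3P: pth => xz zw pth.
by rewrite rcons_path (subadj _ _ xz) (subadj _ _ zw) (sub_path subadj pth) -lastp adjC.
Qed.

(** Each vertex other than r is sent to a neighbour strictly closer to r, where [D] is the distance
    to r. The edges used connect everything, and acyclicity leaves room for no other edge. *)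
Lemma tree_parent_fn G r : is_tree G -> exists2 f, parent_fn r f & fedges f = G.
Proof.
case=> sG [V0 cG] aG.
have exD x : exists n, [exists p : n.-tuple V, path (adj G) x p && (last x p == r)].
  have /connectP[p pth ->] := cG x r.
  by exists (size p); apply/existsP; exists (in_tuple p); rewrite pth eqxx.
pose D x := ex_minn (exD x).
have Dle x p : path (adj G) x p -> last x p = r -> D x <= size p.
  move=> pth lst; rewrite /D; case: ex_minnP => m _; apply.
  by apply/existsP; exists (in_tuple p); rewrite pth lst eqxx.
have step x : x != r -> exists2 y, adj G x y & D y < D x.
  move=> xr; have : [exists p : (D x).-tuple V, path (adj G) x p && (last x p == r)].
    by rewrite /D; case: ex_minnP.
  case/existsP=> -[p /= /eqP szp] /andP[pth /eqP lst].
  case: p pth lst szp => [/= _ xr'|y p /= /andP[xy pth] lst szp].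
    by rewrite xr' eqxx in xr.
  by exists y => //; rewrite -szp ltnS Dle.
have Dr : D r = 0 by apply/eqP; rewrite -leqn0; apply: (Dle r [::]).
pose f := [ffun x => odflt x [pick y | adj G x y && (D y < D x)]].
have fP x : x != r -> adj G x (f x) && (D (f x) < D x).
  move=> /step[y xy Dy]; rewrite ffunE; case: pickP => [z //|/(_ y)].
  by rewrite xy Dy.
have fr : f r = r by rewrite ffunE; case: pickP => //= y; rewrite Dr andbF.
have pf : parent_fn r f.
  rewrite /parent_fn fr eqxx; apply/forallP => x.
  have [n] := ubnP (D x); elim: n x => // n IHn x; rewrite ltnS => Dx.
  case: (eqVneq x r) => [->|xr]; first exact: connect0.
  apply: connect_trans (fconnect1 _ _) (IHn _ _).
  by have /andP[_ Dfx] := fP _ xr; apply: leq_trans Dfx Dx.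
exists f => //; apply: acyclic_spanning sG aG (parent_fn_connected pf) _.
apply/subsetP => e /imsetP[x]; rewrite inE => fx ->.
have /fP/andP[//] : x != r by apply: contraNneq fx => ->; rewrite fr.
Qed.

(** A disagreement propagates along g up to r, where both functions are fixed. If f x differs from g
    x, the common edge between x and g x must come from f (g x) = x, whereas g (g x) = x would put x
    on a cycle of g. *)
Lemma parent_fn_inj r f g : parent_fn r f -> parent_fn r g ->
  fedges f = fedges g -> f = g.
Proof.
move=> pf pg E; apply/ffunP => x0; apply/eqP; apply/contraT => x0P.
have step x : f x != g x -> f (g x) != g (g x).
  move=> fgx; have xr : x != r.
    by apply: contraNneq fgx => ->; rewrite !parent_fn_root.
  have gx : x != g x by apply: contraNneq xr => /esym gx; rewrite (parent_fn_fixed pg gx).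
  have : adj (fedges f) x (g x) by rewrite E adj_fedges gx eqxx.
  rewrite adj_fedges gx (negbTE fgx) /= => /eqP ->.
  apply: contraNneq xr => ggx; rewrite -(parent_fn_cyc x pg) /cyc {2}ggx.
  exact: fconnect1.
have : f r != g r.
  have /iter_findex <- := parent_fn_connect x0 pg.
  by elim: (findex g x0 r) => //= n; apply: step.
by rewrite !parent_fn_root ?eqxx.
Qed.

Definition parent_fns : {set {ffun V -> V}} := [set f | [exists r, parent_fn r f]].

Lemma card_parent_fns_fiber G : is_tree G ->
  #|[set f in parent_fns | fedges f == G]| = #|V|.
Proof.
move=> tG.
have ex r : exists f, parent_fn r f && (fedges f == G).
  by have [f pf <-] := tree_parent_fn r tG; exists f; rewrite pf eqxx.
pose F r := xchoose (ex r).
have FP r : parent_fn r (F r) /\ fedges (F r) = G.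
  by have /andP[? /eqP] := xchooseP (ex r).
have injF : injective F.
  move=> r s Frs; have [pr _] := FP r; have [ps _] := FP s.
  by apply: parent_fn_fixed ps _; rewrite -Frs parent_fn_root.
rewrite -cardsT -(card_imset _ injF); apply: eq_card => f; rewrite !inE.
apply/andP/imsetP => [[/existsP[r pf] /eqP fG]|[r _ ->]].
  by exists r => //; have [pF FG] := FP r; apply: parent_fn_inj pf pF _; rewrite fG.
by have [pF ->] := FP r; split=> //; apply/existsP; exists r.
Qed.

Lemma sum_parent_fns (phi : {set {set V}} -> nat) (A : {set {set {set V}}}) :
    (forall G, G \in A <-> is_tree G) ->
  \sum_(f in parent_fns) phi (fedges f) = #|V| * \sum_(G in A) phi G.
Proof.
move=> AP; rewrite (partition_big fedges [in A]) /=; last first.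
  by move=> f; rewrite inE => /existsP[r /parent_fn_tree /AP].
rewrite big_distrr /=; apply: eq_bigr => G /AP tG.
rewrite (eq_bigr (fun=> phi G)); last by move=> f /andP[_ /eqP->].
rewrite sum_nat_const; congr (_ * _); rewrite -(card_parent_fns_fiber tG).
by apply: eq_card => f; rewrite [RHS]inE.
Qed.

End FunctionalGraph.

(** * Trees with two marked vertices and functions *)

Section Joyal.

Variable V : finType.
Implicit Types (f g h : {ffun V -> V}) (x y z r v : V).

(* Rooted forests are the functions whose only cyclic points are fixed points,
   the fixed points being the roots. *)
Definition tie f : {ffun V -> V} := [ffun x => if cyc f x then x else f x].
Definition fixpts h : {set V} := [set x | h x == x].
Definition is_forest h := [forall x, cyc h x ==> (h x == x)].
Definition unspine g v : {ffun V -> V} := [ffun x => if fconnect g v x then x else g x].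

Lemma iter_agree (f g : V -> V) (D : pred V) x n :
  (forall y, D y -> f y = g y /\ D (f y)) -> D x ->
  iter n f x = iter n g x /\ D (iter n f x).
Proof.
move=> fg Dx; elim: n => //= n [<- Dn].
by case: (fg _ Dn).
Qed.

Lemma cyc_period f x : cyc f x -> exists n, iter n.+1 f x = x.
Proof. by move/iter_findex => E; exists (findex f (f x) x); rewrite iterSr. Qed.

Lemma period_cyc f x n : iter n.+1 f x = x -> cyc f x.
Proof. by move=> E; rewrite /cyc -{2}E iterSr fconnect_iter. Qed.

Lemma iter_period (f : V -> V) x n m : iter n f x = x -> iter (m * n) f x = x.
Proof. by move=> E; elim: m => // m IHm; rewrite mulSn iterD IHm. Qed.

(** Iterating f a common multiple of the two periods fixes both points, and the two trajectories
    agree from the first step on. *)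
Lemma cyc_inj f x y : cyc f x -> cyc f y -> f x = f y -> x = y.
Proof.
move=> /cyc_period[n nx] /cyc_period[m my] E.
have := iter_period m.+1 nx; have := iter_period n.+1 my.
by rewrite [(m.+1 * _)%N]mulnC mulnS addSn !iterSr E => -> ->.
Qed.

Lemma tie_cyc f x : cyc f x -> tie f x = x.
Proof. by rewrite ffunE => ->. Qed.

Lemma tie_noncyc f x : ~~ cyc f x -> tie f x = f x.
Proof. by rewrite ffunE => /negbTE ->. Qed.

Lemma iter_tie f n x :
  ~~ cyc f (iter n (tie f) x) -> iter n (tie f) x = iter n f x.
Proof.
elim: n => //= n IHn.
case: (boolP (cyc f (iter n (tie f) x))) => [cn|ncn _]; first by rewrite tie_cyc ?cn.
by rewrite tie_noncyc // IHn.
Qed.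

Lemma cyc_tie f x : cyc (tie f) x = cyc f x.
Proof.
apply/idP/idP => [/cyc_period[n nx]|cx]; last by rewrite /cyc tie_cyc ?connect0.
apply: contraT => ncx; have := @iter_tie f n.+1 x.
by rewrite nx => /(_ ncx)/esym/period_cyc; rewrite (negbTE ncx).
Qed.

Lemma tie_forest f : is_forest (tie f).
Proof. by apply/forallP => x; rewrite cyc_tie; apply/implyP => /tie_cyc/eqP. Qed.

Lemma fixpts_cyc f x : f x = x -> cyc f x.
Proof. by rewrite /cyc => ->; apply: connect0. Qed.

Lemma forestP h x : is_forest h -> cyc h x = (h x == x).
Proof.
by move/forallP/(_ x)/implyP => hx; apply/idP/eqP => [/hx/eqP|/fixpts_cyc].
Qed.

Lemma fixpts_tie f x : (x \in fixpts (tie f)) = cyc f x.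
Proof. by rewrite inE -(forestP _ (tie_forest f)) cyc_tie. Qed.

Lemma forest_noncyc h x : is_forest h -> ~~ cyc h x = (x \notin fixpts h).
Proof. by move=> hf; rewrite inE forestP. Qed.

(** Inverse to [tie]: the permutation p closes the roots of h into cycles. *)
Definition unroot h (p : {perm V}) : {ffun V -> V} :=
  [ffun x => if x \in fixpts h then p x else h x].

Lemma cyc_unroot h p x : is_forest h -> perm_on (fixpts h) p ->
  cyc (unroot h p) x = (x \in fixpts h).
Proof.
move=> hf pC.
have agree y : y \in fixpts h -> unroot h p y = p y /\ unroot h p y \in fixpts h.
  by move=> yC; rewrite ffunE yC; split=> //; rewrite (perm_closed _ pC).
apply/idP/idP => [/cyc_period[n nx]|xC].
  apply: contraT => xC.
  (* The roots are stable under [unroot h p], so a periodic orbit that entered them could not return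
     to x. Staying outside, it would be a cycle of h through a point that is not a root. *)
  have out m : iter m (unroot h p) x \notin fixpts h.
    apply: contra xC => mC; rewrite -[x](iter_period m.+1 nx).
    have -> : (m.+1 * n.+1 = (m * n + n.+1) + m)%N by lia.
    rewrite iterD.
    by case: (iter_agree (m * n + n.+1) agree mC).
  have agreeh m : iter m (unroot h p) x = iter m h x.
    by elim: m => //= m <-; rewrite ffunE (negbTE (out m)).
  by case/negP: xC; rewrite inE -forestP //; apply: (@period_cyc _ _ n); rewrite -agreeh.
have xp : fconnect p (p x) x.
  by rewrite fconnect_sym ?fconnect1 //; apply: perm_inj.
have /iter_findex E := xp.
apply: (@period_cyc _ _ (findex p (p x) x)).
by have [-> _] := iter_agree (findex p (p x) x).+1 agree xC; rewrite iterSr.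
Qed.

Lemma card_tie_fiber h : is_forest h -> #|[set f | tie f == h]| = (#|fixpts h|)`!.
Proof.
move=> hf; rewrite -card_perm.
have inj : {in perm_on (fixpts h) &, injective (unroot h)}.
  move=> p q; rewrite !unfold_in => pC qC /ffunP E; apply/permP => x.
  case: (boolP (x \in fixpts h)) => xC; last by rewrite (out_perm pC xC) (out_perm qC xC).
  by move: (E x); rewrite !ffunE xC.
rewrite -(card_in_imset inj); apply: eq_card => f; rewrite inE.
apply/eqP/imsetP => [fh|[p pC ->]]; last first.
  apply/ffunP => x; rewrite ffunE cyc_unroot // ffunE.
  by case: (boolP (x \in _)) => // /[!inE] /eqP.
have CE x : (x \in fixpts h) = cyc f x by rewrite -fh fixpts_tie.
pose q x := if x \in fixpts h then f x else x.
have fC x : x \in fixpts h -> f x \in fixpts h.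
  by rewrite !CE => /(cyc_iter 1).
have injq : injective q.
  move=> x y; rewrite /q; case: ifP => xC; case: ifP => yC //.
  - by apply: cyc_inj; rewrite -CE.
  - by move=> E; rewrite -E fC in yC.
  - by move=> E; rewrite E fC in xC.
exists (perm injq).
  by apply/subsetP => x; rewrite inE permE /q; case: ifP => // _; rewrite eqxx.
apply/ffunP => x; rewrite ffunE permE /q; case: (boolP (x \in _)) => // xC.
by rewrite -fh tie_noncyc // -CE.
Qed.

(** Links the roots in the order of s into a spine. The default of [nth] is x itself, so the last
    entry of s is fixed and becomes the root of the tree. *)
Definition thread h (s : seq V) : {ffun V -> V} :=
  [ffun x => if x \in s then nth x s (index x s).+1 else h x].

Section Thread.

Variables (h : {ffun V -> V}) (s : seq V) (v : V).
Hypotheses (hf : is_forest h) (uniq_vs : uniq (v :: s)).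
Hypothesis (mem_vs : v :: s =i fixpts h).
Let g := thread h (v :: s).

Lemma thread_nth i : i < size s -> g (nth v (v :: s) i) = nth v (v :: s) i.+1.
Proof.
move=> lti; have lti' : i < size (v :: s) by rewrite ltnW.
by rewrite ffunE mem_nth // index_uniq //; apply: set_nth_default.
Qed.

Lemma thread_last : g (last v s) = last v s.
Proof.
by rewrite ffunE mem_last nth_default // index_last.
Qed.

Lemma thread_iter i : i <= size s -> iter i g v = nth v (v :: s) i.
Proof. by elim: i => // i IHi lti; rewrite iterS IHi 1?ltnW // thread_nth. Qed.

Lemma thread_fconnect x : fconnect g v x = (x \in v :: s).
Proof.
apply/idP/idP => [/iter_findex <-|xs].
  elim: (findex g v x) => [|n]; first exact: mem_head.
  rewrite iterS ffunE => ns; rewrite ns.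
  set y := iter n _ _ in ns *; case: (ltnP (index y (v :: s)).+1 (size (v :: s))) => lt.
    exact: mem_nth.
  by rewrite nth_default.
have lti : index x (v :: s) <= size s by rewrite -ltnS index_mem.
by rewrite -(nth_index v xs) -(thread_iter lti) fconnect_iter.
Qed.

Lemma unspine_thread : unspine g v = h.
Proof.
apply/ffunP => x; rewrite ffunE thread_fconnect ffunE.
by case: (boolP (x \in _)) => //; rewrite mem_vs inE => /eqP.
Qed.

Lemma orbit_thread : orbit g v = v :: s.
Proof.
have sz : size (orbit g v) = size (v :: s).
  rewrite size_orbit /order -(card_uniqP uniq_vs); apply: eq_card => x.
  by rewrite inE thread_fconnect.
apply: (@eq_from_nth _ v) => // i; rewrite sz => lti.
rewrite -thread_iter // nth_traject //.
by rewrite -size_orbit sz.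
Qed.

Lemma thread_parent_fn : parent_fn (last v s) g.
Proof.
rewrite /parent_fn thread_last eqxx; apply/forallP => x.
have connect_in y : y \in v :: s -> fconnect g y (last v s).
  rewrite -thread_fconnect => /iter_findex <-; set n := findex g v y.
  have rfix k : iter k g (last v s) = last v s.
    by elim: k => //= k ->; rewrite thread_last.
  have Ev : iter (size s) g v = last v s.
    by rewrite thread_iter // -[size s]/((size (v :: s)).-1) nth_last.
  have [le|lt] := leqP n (size s).
    by rewrite -Ev -(subnK le) iterD fconnect_iter.
  by rewrite -(subnK (ltnW lt)) iterD Ev rfix connect0.
(* Induction on the depth in h: off the spine [g] moves as h does, until a root of h, that is, a
   spine vertex, is met. *)
have [n] := ubnP (order h x); elim: n x => // n IHn x; rewrite ltnS => lex.
have [xs|xs] := boolP (x \in v :: s); first exact: connect_in.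
have gx : g x = h x by rewrite ffunE (negbTE xs).
apply: connect_trans (fconnect1 _ _) _; rewrite gx; apply: IHn.
by rewrite mem_vs -forest_noncyc // in xs; rewrite -(order_noncyc xs).
Qed.

End Thread.

Lemma unspine_noncyc g r v x : parent_fn r g -> (unspine g v x == x) = fconnect g v x.
Proof.
move=> pg; rewrite ffunE; case: (boolP (fconnect g v x)) => [_|xs]; first by rewrite eqxx.
apply/negbTE; apply: contra xs => /eqP/(parent_fn_fixed pg) ->.
exact: parent_fn_connect pg.
Qed.

Lemma unspine_forest g r v : parent_fn r g -> is_forest (unspine g v).
Proof.
move=> pg; apply/forallP => x; apply/implyP; rewrite (unspine_noncyc _ _ pg).
move=> /cyc_period[n nx]; apply: contraT => xs.
have fixv y : fconnect g v y -> unspine g v y = y by rewrite ffunE => ->.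
have agree m : ~~ fconnect g v (iter m (unspine g v) x) ->
    iter m (unspine g v) x = iter m g x.
  elim: m => //= m IHm; case: (boolP (fconnect g v (iter m (unspine g v) x))) => sm.
    by rewrite fixv // sm.
  by move=> _; rewrite ffunE (negbTE sm) IHm.
have /period_cyc : iter n.+1 g x = x by rewrite -agree nx.
rewrite (parent_fn_cyc _ pg) => /eqP xr.
by rewrite xr (parent_fn_connect _ pg) in xs.
Qed.

Lemma thread_orbit g r v : parent_fn r g -> thread (unspine g v) (orbit g v) = g.
Proof.
move=> pg; apply/ffunP => x; rewrite !ffunE !fconnect_orbit.
case: (boolP (x \in _)) => // xs; set i := index x _.
have lti : i < order g v by rewrite -size_orbit index_mem.
have Ex : iter i g v = x by rewrite -(nth_traject _ lti) -/(orbit g v) nth_index.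
have [lti1|lei1] := ltnP i.+1 (order g v).
  rewrite (set_nth_default v) ?size_orbit // /orbit nth_traject //.
  by rewrite iterS Ex.
rewrite nth_default ?size_orbit //.
have rfix k : iter k g r = r by elim: k => //= k ->; rewrite (parent_fn_root pg).
have vr := parent_fn_connect v pg.
have Er := iter_findex vr; have ltr : findex g v r <= i.
  by rewrite -ltnS (leq_trans _ lei1) // findex_max.
have -> : x = r by rewrite -Ex -(subnK ltr) iterD Er rfix.
by rewrite (parent_fn_root pg).
Qed.

(** The pairs (g, v) over h correspond to the orderings of the roots of h: (g, v) yields
    [orbit g v], which lists the spine, and an ordering s yields [thread h s] with the head of s. *)
Lemma card_unspine_fiber h : 0 < #|V| -> is_forest h ->
  #|[set p : {ffun V -> V} * V | (p.1 \in parent_fns V) && (unspine p.1 p.2 == h)]|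
    = (#|fixpts h|)`!.
Proof.
move=> /card_gt0P[x0 _] hf; rewrite -ffactnn -(card_uniq_tuples _ [in fixpts h]).
set j := #|fixpts h|.
have fix_gt0 : 0 < j.
  have [n] := ubnP (order h x0); elim: n x0 => // n IHn x0; rewrite ltnS => lex.
  have [xs|xs] := boolP (x0 \in fixpts h); first by apply/card_gt0P; exists x0.
  by rewrite -forest_noncyc // in xs; apply: (IHn (h x0)); rewrite -order_noncyc.
pose F (s : j.-tuple V) := (thread h s, head x0 s).
have sP (s : j.-tuple V) : s \in [set t : j.-tuple V | all [in fixpts h] t & uniq t] ->
    exists v s', [/\ s = v :: s' :> seq V, uniq (v :: s') & v :: s' =i fixpts h].
  rewrite inE => /andP[/allP sC us].
  have memsC : s =i fixpts h.
    by apply/subset_cardP; [rewrite (card_uniqP us) size_tuple | apply/subsetP].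
  case: s sC us memsC => -[|v s'] /= szs sC us mem_s; last by exists v, s'.
  by move: fix_gt0; rewrite -(eqP szs).
have injF : {in [set t : j.-tuple V | all [in fixpts h] t & uniq t] &, injective F}.
  move=> s t /sP[v [s' [Es us ms]]] /sP[w [t' [Et ut mt]]].
  rewrite /F Es Et /= => -[E1 E2]; apply: val_inj; rewrite /= Es Et.
  have : orbit (thread h (v :: s')) v = orbit (thread h (w :: t')) w by rewrite E1 E2.
  by rewrite !orbit_thread.
rewrite -(card_in_imset injF); apply: eq_card => -[g v]; rewrite inE /=.
apply/andP/imsetP => [[]|[s /sP[w [s' [Es us ms]]]]]; last first.
  rewrite /F Es /= => -[-> ->]; rewrite unspine_thread // eqxx inE; split=> //.
  by apply/existsP; exists (last w s'); apply: thread_parent_fn.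
rewrite inE => /existsP[r pg] /eqP E.
have memo : orbit g v =i fixpts h.
  by move=> x; rewrite -E inE (unspine_noncyc _ _ pg) fconnect_orbit.
have szo : size (orbit g v) == j.
  by apply/eqP; rewrite -(card_uniqP (orbit_uniq g v)); apply: eq_card.
exists (Tuple szo).
  by rewrite inE /= orbit_uniq andbT; apply/allP => x /=; rewrite memo.
rewrite /F /= -[X in thread X]E (thread_orbit _ pg); congr pair.
by rewrite /orbit -orderSpred.
Qed.

Lemma card_parent_pairs_fiber h : 0 < #|V| ->
  #|[set f | tie f == h]| =
  #|[set p : {ffun V -> V} * V | (p.1 \in parent_fns V) && (unspine p.1 p.2 == h)]|.
Proof.
move=> V0; have [hf|hnf] := boolP (is_forest h).
  by rewrite card_tie_fiber // card_unspine_fiber.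
rewrite !eq_card0 //.
  case=> g v; rewrite !inE; apply/negP => /andP[/existsP[r pg] /eqP E].
  by case/negP: hnf; rewrite -E (unspine_forest v pg).
by move=> f; rewrite !inE; apply: contraNF hnf => /eqP <-; apply: tie_forest.
Qed.

(* Joyal's bijection, on the level of forests: over a forest h with j roots lie
   j! functions (permute the roots) and j! bipointed trees (order the roots). *)
Lemma sum_unspine_tie (phi : {ffun V -> V} -> nat) : 0 < #|V| ->
  \sum_(g in parent_fns V) \sum_v phi (unspine g v) = \sum_f phi (tie f).
Proof.
move=> V0; rewrite pair_big_dep /=.
rewrite (partition_big (fun p : {ffun V -> V} * V => unspine p.1 p.2) predT) //=.
rewrite [RHS](partition_big tie predT) //=; apply: eq_bigr => h _.
rewrite (eq_bigr (fun=> phi h)); last by move=> p /andP[_ /eqP->].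
rewrite [RHS](eq_bigr (fun=> phi h)); last by move=> p /eqP->.
rewrite !sum_nat_const; congr (_ * _).
transitivity #|[set f | tie f == h]|; last by apply: eq_card => f; rewrite inE.
rewrite card_parent_pairs_fiber //; apply: eq_card => p.
by rewrite [RHS]inE unfold_in /= andbT.
Qed.

End Joyal.

(** * Path systems *)

Section PathSystems.

Variable V : finType.
Implicit Types (f g h : {ffun V -> V}) (x y z r v : V) (G : {set {set V}}).
Implicit Types (s : seq V) (ss : seq (seq V)) (l : nat).

(** Length at least l means more than l vertices, and uniqueness of the single paths together with
    their disjointness is uniqueness of the concatenation. *)
Lemma path_systemE G l ss :
  path_system G l ss =
  all (fun s => (l < size s) && sorted (adj G) s) ss && uniq (flatten ss).
Proof.
rewrite /path_system; elim: ss => //= s ss IH.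
rewrite cat_uniq; set D := all (fun s2 : seq V => [disjoint s & s2]) ss.
have -> : ~~ has [in s] (flatten ss) = D.
  rewrite {}/D {IH}; elim: ss => //= s' ss <-.
  by rewrite has_cat negb_or disjoint_sym disjoint_has.
have -> : is_path G s && (l <= path_length s) =
    [&& l < size s, sorted (adj G) s & uniq s].
  rewrite /is_path /path_length; case: s D => //= x s _; rewrite ltnS.
  by rewrite andbC.
rewrite andbACA {}IH.
case: (l < _) => //=; case: (sorted _ s) => //=; case: D; rewrite ?andbF ?andbT //=.
by rewrite andbCA.
Qed.

Lemma covered_card ss : uniq (flatten ss) -> #|covered ss| = size (flatten ss).
Proof. by move=> us; rewrite -(card_uniqP us); apply: eq_card => v; rewrite inE. Qed.

Lemma path_system_cov G l ss : path_system G l ss -> size (flatten ss) <= cov l G.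
Proof.
move=> ps; have := ps; rewrite path_systemE => /andP[_ /covered_card <-].
by rewrite /cov (bigmax_sup (covered ss)) //; apply/asboolP; exists ss.
Qed.

(** A prefix of l + 1 vertices is cut off as long as at least 2 l + 2 remain, so the rest always
    keeps at least l + 1. *)
Lemma chop_path (G : {set {set V}}) l s : l < size s -> sorted (adj G) s ->
  exists cs, flatten cs = s /\
    all (fun c => [&& l < size c, size c <= l.*2.+1 & sorted (adj G) c]) cs.
Proof.
have [n] := ubnP (size s); elim: n s => // n IHn s; rewrite ltnS => sz ls srt.
have [le|lt] := leqP (size s) l.*2.+1.
  by exists [:: s]; rewrite /= cats0 ls le srt.
have szd : size (drop l.+1 s) = size s - l.+1 by rewrite size_drop.
have [||cs [fl al]] := IHn (drop l.+1 s) _ _ (drop_sorted _ srt); try (rewrite szd; lia).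
exists (take l.+1 s :: cs); rewrite /= fl cat_take_drop al andbT take_sorted // andbT.
by rewrite size_takel // ltnSn /= -addnn; split=> //; lia.
Qed.

Lemma chop_path_system G l ss : path_system G l ss ->
  exists2 ss', path_system G l ss' &
    flatten ss' = flatten ss /\ all (fun s => size s <= l.*2.+1) ss'.
Proof.
rewrite path_systemE => /andP[al un].
have [ss' fl al'] : exists2 ss', flatten ss' = flatten ss &
    all (fun c => [&& l < size c, size c <= l.*2.+1 & sorted (adj G) c]) ss'.
  elim: ss al {un} => [|s ss IH /= /andP[/andP[ls srt] /IH[ss' fl al]]].
    by exists [::].
  have [cs [fl' al']] := chop_path ls srt.
  by exists (cs ++ ss'); rewrite ?flatten_cat ?fl' ?fl // all_cat al'.
exists ss'; last first.
  by split=> //; apply: sub_all al' => s /and3P[].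
rewrite path_systemE fl un andbT.
by apply: sub_all al' => s /and3P[-> _ ->].
Qed.

(** The bound on the sizes is what makes cov Lipschitz: spoiling one path then loses at most 2 l + 1
    covered vertices. *)
Lemma cov_witness G l : exists ss,
  [/\ path_system G l ss, cov l G = size (flatten ss) &
      all (fun s => size s <= l.*2.+1) ss].
Proof.
have ex0 : 0 < #|[pred S : {set V} | `[< exists ss, path_system G l ss /\ S = covered ss >]]|.
  by apply/card_gt0P; exists (covered [::]); apply/asboolP; exists [::].
have [S /asboolP[ss [ps ->]] E] := eq_bigmax_cond (fun S : {set V} => #|S|) ex0.
have [ss' ps' [fl al]] := chop_path_system ps.
exists ss'; split=> //; rewrite fl -covered_card; first exact: E.
by move: ps; rewrite path_systemE => /andP[].
Qed.

(** The vertices counted by N_k. Leaving out the cyclic points makes the set a function of the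
    forest [tie f] alone ([deep_tie]). *)
Definition deep k f : {set V} := [set v | ~~ cyc f v && [exists w, iter k f w == v]].

Lemma deepP k f v :
  reflect (~~ cyc f v /\ exists w, iter k f w = v) (v \in deep k f).
Proof.
rewrite inE; apply: (iffP andP) => -[ncv].
  by case/existsP=> w /eqP; split=> //; exists w.
by case=> w /eqP wv; split=> //; apply/existsP; exists w.
Qed.

Lemma noncyc_prefix f i k w : i <= k -> ~~ cyc f (iter k f w) -> ~~ cyc f (iter i f w).
Proof. by move=> le; apply: contra => /(cyc_iter (k - i)); rewrite -iterD subnK. Qed.

Lemma traject_iter (f : V -> V) x n : traject f x n = [seq iter i f x | i <- iota 0 n].
Proof.
apply: (@eq_from_nth _ x); rewrite size_traject ?size_map ?size_iota // => i lti.
by rewrite nth_traject // (nth_map 0) ?size_iota // nth_iota.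
Qed.

Lemma noncyc_neq f x : ~~ cyc f x -> f x != x.
Proof. by apply: contraNneq => /fixpts_cyc. Qed.

Lemma noncyc_path f n x : ~~ cyc f (iter n f x) ->
  path (adj (fedges f)) x (traject f (f x) n).
Proof.
elim: n x => //= n IHn x ncx; rewrite IHn -?iterSr // andbT adj_fedges eqxx andbT.
by rewrite eq_sym noncyc_neq //; apply: (noncyc_prefix (leq0n n.+1)) ncx.
Qed.

Lemma deep_tie k f : deep k (tie f) = deep k f.
Proof.
apply/setP => v; apply/deepP/deepP; rewrite cyc_tie => -[ncv [w E]]; split=> //.
  by exists w; rewrite -E iter_tie // E.
exists w; rewrite -E in ncv *; elim: k ncv {E} => //= k IHk ncv.
have ncw := @noncyc_prefix f k k.+1 w (leqnSn _) ncv.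
by rewrite IHk // tie_noncyc.
Qed.

Lemma order_iter_noncyc f k w :
  ~~ cyc f (iter k f w) -> order f w = order f (iter k f w) + k.
Proof.
elim: k => [|k IHk] ncw; first by rewrite addn0.
have ncw' := @noncyc_prefix f k k.+1 w (leqnSn _) ncw.
by rewrite (IHk ncw') (order_noncyc ncw') iterS addSnnS.
Qed.

(* Pigeonhole on the depth modulo l + 1: the descending paths of length l that
   start at depths of one residue class are pairwise disjoint. *)
Lemma deep_le_cov G h l : is_forest h -> fedges h \subset G -> #|deep l h| <= cov l G.
Proof.
move=> hf hG.
pose A i := [set v in deep l h | order h v %% l.+1 == i :> nat].
have [i leA] : exists i : 'I_l.+1, #|deep l h| <= l.+1 * #|A i|.
  apply/existsP; apply: contraT => /existsPn ltA.
  have : \sum_(i < l.+1) #|A i| = #|deep l h|.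
    rewrite -sum1_card (partition_big (fun v => inord (order h v %% l.+1) : 'I_l.+1) predT) //=.
    apply: eq_bigr => i _; rewrite -sum1_card; apply: eq_bigl => v.
    by rewrite [LHS]inE -val_eqE /= inordK // ltn_pmod.
  have le (i : 'I_l.+1) : l.+1 * #|A i| <= #|deep l h|.-1 by have := ltA i; lia.
  have D0 : 0 < #|deep l h| by have := ltA ord0; lia.
  have : \sum_(i < l.+1) l.+1 * #|A i| <= l.+1 * #|deep l h|.-1.
    by rewrite -[X in _ <= X * _]card_ord -sum_nat_const; apply: leq_sum.
  by rewrite -big_distrr /= leq_pmul2l // => le' E; rewrite E in le'; lia.
apply: leq_trans leA _.
pose wit v := odflt v [pick w | iter l h w == v].
have witP v : v \in A i -> [/\ iter l h (wit v) = v, ~~ cyc h v & order h v %% l.+1 = i].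
  rewrite inE => /andP[/deepP[ncv [w Ew]] /eqP oi]; split=> //.
  by rewrite /wit; case: pickP => [x /eqP|/(_ w)] //; rewrite Ew eqxx.
pose ss := [seq traject h (wit v) l.+1 | v <- enum (A i)].
have Ess : flatten ss = [seq iter j h (wit v) | v <- enum (A i), j <- iota 0 l.+1].
  by congr flatten; apply: eq_map => v; rewrite traject_iter.
have ps : path_system G l ss.
  rewrite path_systemE; apply/andP; split.
    apply/allP => s /mapP[v]; rewrite mem_enum => vA ->.
    rewrite size_traject ltnSn /=; have [Ev ncv _] := witP v vA.
    have subadj : subrel (adj (fedges h)) (adj G) by move=> x y; apply: (subsetP hG).
    by apply: (sub_path subadj); apply: noncyc_path; rewrite Ev.
  rewrite Ess; apply: allpairs_uniq; rewrite ?enum_uniq ?iota_uniq //.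
  move=> p q /allpairsP[[v j] [vA jl ->]] /allpairsP[[v' j'] [vA' jl' ->]] {p q}.
  rewrite !mem_enum in vA vA'; rewrite !mem_iota in jl jl'.
  move: vA jl vA' jl' => /= vA jl vA' jl'.
  have [Ev ncv iv] := witP v vA; have [Ev' ncv' iv'] := witP v' vA'.
  move=> E.
  have ord u k : iter l h (wit u) = u -> ~~ cyc h u -> k <= l ->
      order h (iter k h (wit u)) = order h u + (l - k).
    move=> Eu ncu kl; have E' : iter (l - k) h (iter k h (wit u)) = u.
      by rewrite -iterD subnK.
    by rewrite (@order_iter_noncyc h (l - k)) E'.
  (* By [ord], the vertex at position j has depth [order h v + (l - j)]. All endpoints v have the
     same depth modulo l + 1, so the residue of the depth determines j. *)
  have jj' : j = j'.
    have := ord v j Ev ncv jl; rewrite E (ord v' j' Ev' ncv' jl').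
    move/(congr1 (modn^~ l.+1)); rewrite -modnDml iv' -[in RHS]modnDml iv.
    move/eqP; rewrite eqn_modDl !modn_small; lia.
  have : iter (l - j) h (iter j h (wit v)) = iter (l - j') h (iter j' h (wit v')).
    by rewrite E jj'.
  by rewrite -!iterD !subnK // Ev Ev' jj' => ->.
apply: leq_trans (path_system_cov ps).
by rewrite Ess size_allpairs size_iota mulnC -cardE.
Qed.


(** * Upper bound on cov: a set that every long path meets often *)

Definition spine g v : {set V} := [set x | fconnect g v x].

(** Built so that every path with at least 8 k vertices meets it in at least k of them
    ([path_branch]). A spine of fewer than 2 k vertices is left out, so that the spine contributes
    at most its squared size over 2 k. *)
Definition branch k g v : {set V} :=
  deep k (unspine g v) :|: (if k.*2 <= #|spine g v| then spine g v else set0).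

Lemma spine_fixpts g r v : parent_fn r g -> spine g v = fixpts (unspine g v).
Proof. by move=> pg; apply/setP => x; rewrite !inE (unspine_noncyc _ _ pg). Qed.

(** A path in a rooted tree climbs towards the root and then descends: after one descending step
    ([down]), climbing would go back to the vertex just left. *)
Lemma tree_path_split r g s : parent_fn r g -> sorted (adj (fedges g)) s -> uniq s ->
  exists s1 s2, [/\ s = s1 ++ s2, sorted (frel g) s1 & sorted (frel g) (rev s2)].
Proof.
move=> pg; under eq_exists do under eq_exists do rewrite rev_sorted.
have down x y s' : g y = x -> path (adj (fedges g)) y s' -> uniq [:: x, y & s'] ->
    path (fun a b => g b == a) y s'.
  elim: s' x y => //= z s' IH x y gy /andP[yz pz] /and3P[].
  rewrite !inE !negb_or => /and3P[xy xz xs] /andP[yz' ys] us.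
  move: yz; rewrite adj_fedges => /andP[_]; rewrite gy (negbTE xz) /= => /eqP gz.
  by rewrite gz eqxx /=; apply: (IH y) => //=; rewrite inE negb_or yz' ys.
elim: s => [|x s IH]; first by exists [::], [::].
case: s IH => [_ _ _|y s IH]; first by exists [:: x], [::].
move=> /[dup] xys /= /andP[xy ys] /[dup] us /= /andP[_ us'].
move: xy; rewrite adj_fedges => /andP[nxy /orP[/eqP gx|/eqP gy]].
  have [[|y' s1] [s2 /= [E srt1 srt2]]] := IH ys us'.
    by exists [:: x], s2; rewrite E.
  exists [:: x, y' & s1], s2; rewrite /= E; split=> //; rewrite srt1 andbT.
  by case: E => <- _; apply/eqP.
by exists [::], [:: x, y & s]; split=> //=; rewrite gy eqxx (down x).
Qed.

Lemma tree_path_chain r g s : parent_fn r g -> sorted (adj (fedges g)) s -> uniq s ->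
  exists y n, [/\ size s <= n.*2, {subset traject g y n <= s} & uniq (traject g y n)].
Proof.
move=> pg srt us; have [s1 [s2 [E srt1 srt2]]] := tree_path_split pg srt us.
have [t [st tsz tsub ut]] : exists t, [/\ sorted (frel g) t,
    size s <= (size t).*2, {subset t <= s} & uniq t].
  move: us; rewrite E cat_uniq => /and3P[us1 _ us2].
  case: (leqP (size s1) (size s2)) => le.
    exists (rev s2); rewrite size_rev rev_uniq; split=> // [|x].
      by rewrite size_cat -addnn leq_add2r.
    by rewrite mem_rev mem_cat orbC => ->.
  exists s1; split=> // [|x].
    by rewrite size_cat -addnn leq_add2l ltnW.
  by rewrite mem_cat => ->.
case: t st tsz tsub ut => [|y t] st tsz tsub ut.
  by case: s tsz {srt us E tsub} => // _; exists r, 0.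
case/fpathP: st tsz tsub ut => n -> /=; rewrite size_traject => tsz tsub ut.
by exists y, n.+1.
Qed.

Lemma iter_unspine g v i x : ~~ fconnect g v (iter i g x) -> iter i (unspine g v) x = iter i g x.
Proof.
elim: i => //= i IHi nci; have nci' : ~~ fconnect g v (iter i g x).
  by apply: contra nci => ci; apply: connect_trans ci (fconnect1 _ _).
by rewrite IHi // ffunE (negbTE nci').
Qed.

(** The case distinction is on the position 2 k - 1 of the ascending chain. If it lies on the spine,
    so do the positions from 2 k to 4 k - 1, and the spine has at least 2 k vertices. Otherwise the
    positions from k to 2 k - 1 are off the spine, each with k chain vertices below it, hence
    deep. *)
Lemma chain_branch r g v k n y : parent_fn r g -> 0 < k -> 4 * k <= n ->
    uniq (traject g y n) ->
  exists2 t : seq V, uniq t /\ size t = k &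
    {subset t <= traject g y n} /\ {subset t <= branch k g v}.
Proof.
move=> pg k0 kn un.
have main a : a + k <= n -> (forall i, a <= i < a + k -> iter i g y \in branch k g v) ->
    exists2 t : seq V, uniq t /\ size t = k &
    {subset t <= traject g y n} /\ {subset t <= branch k g v}.
  move=> akn inB; pose t := [seq iter i g y | i <- iota a k].
  have Et : t = take k (drop a (traject g y n)).
    rewrite /t traject_iter -map_drop -map_take drop_iota add0n take_iota.
    by rewrite (minn_idPl _) //; lia.
  exists t; first by split; [rewrite Et take_uniq // drop_uniq | rewrite size_map size_iota].
  split=> x; first by rewrite Et => /mem_take/mem_drop.
  by case/mapP=> i; rewrite mem_iota => /inB ? ->.
have up i j : i <= j -> fconnect g v (iter i g y) -> fconnect g v (iter j g y).
  move=> ij ci; rewrite -(subnK ij) iterD.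
  exact: connect_trans ci (fconnect_iter _ _ _).
have [cP|ncP] := boolP (fconnect g v (iter k.*2.-1 g y)).
  have inP i : k.*2 <= i -> iter i g y \in spine g v.
    by move=> ki; rewrite inE; apply: up cP; rewrite -addnn in ki *; lia.
  apply: (main k.*2) => [|i /andP[ki _]]; first by rewrite -addnn; lia.
  rewrite inE; case: ifP => [_|/negP[]]; first by rewrite inP ?orbT.
  have u2 : uniq [seq iter i g y | i <- iota k.*2 k.*2].
    have -> : [seq iter i g y | i <- iota k.*2 k.*2] =
        take k.*2 (drop k.*2 (traject g y n)).
      rewrite traject_iter -map_drop -map_take drop_iota add0n take_iota.
      by rewrite (minn_idPl _) // -addnn; lia.
    by rewrite take_uniq // drop_uniq.
  rewrite -[X in X <= _](size_iota k.*2) -(size_map (fun i => iter i g y)).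
  rewrite -(card_uniqP u2); apply: subset_leq_card; apply/subsetP => x.
  by case/mapP=> j; rewrite mem_iota => /andP[kj _] ->; apply: inP.
apply: (main k) => [|i /andP[ki ik]]; first by lia.
rewrite inE; apply/orP; left.
have nci : ~~ fconnect g v (iter i g y).
  by apply: contra ncP; apply: up; rewrite -addnn; lia.
apply/deepP; rewrite (forestP _ (unspine_forest v pg)) (unspine_noncyc _ _ pg); split=> //.
exists (iter (i - k) g y).
by rewrite iter_unspine -iterD subnKC.
Qed.

Lemma path_branch r g v k l s : parent_fn r g -> 0 < k -> 8 * k <= l.+1 ->
  l < size s -> sorted (adj (fedges g)) s -> uniq s -> k <= count [in branch k g v] s.
Proof.
move=> pg k0 kl ls srt us; have [y [n [sn sub un]]] := tree_path_chain pg srt us.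
have [|t [ut <-] [tsub tB]] := chain_branch v pg k0 _ un.
  by rewrite -addnn in sn; lia.
rewrite -size_filter; apply: uniq_leq_size => // x xt.
by rewrite mem_filter tB // sub // tsub.
Qed.

Lemma cov_le_branch r g v k l : parent_fn r g -> 0 < k -> 8 * k <= l.+1 ->
  k * cov l (fedges g) <= l.*2.+1 * #|branch k g v|.
Proof.
move=> pg k0 kl; have [ss [ps -> al]] := cov_witness (fedges g) l.
move: ps; rewrite path_systemE => /andP[al' us].
have le : count [in branch k g v] (flatten ss) <= #|branch k g v|.
  rewrite -size_filter -(card_uniqP (filter_uniq _ us)); apply: subset_leq_card.
  by apply/subsetP => x; rewrite mem_filter => /andP[].
apply: leq_trans (leq_mul (leqnn _) le).
elim: ss al al' us {le} => [|s ss IH] /=; first by rewrite !muln0.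
move=> /andP[sz al] /andP[/andP[ls srt] al'].
rewrite cat_uniq => /and3P[us _ uss]; rewrite size_cat count_cat !mulnDr leq_add ?IH //.
by rewrite mulnC leq_mul // (path_branch v pg k0 kl).
Qed.

Lemma cov_le_unspine r g v k l : parent_fn r g -> 0 < k -> 8 * k <= l.+1 -> l.+1 < 8 * k.+1 ->
  2 * k * cov l (fedges g) <=
  64 * k * #|deep k (unspine g v)| + 32 * #|fixpts (unspine g v)| ^ 2.
Proof.
move=> pg k0 kl lk; have := cov_le_branch v pg k0 kl.
(* From l <= 8 k + 6 and k >= 1 follows 2 l + 1 <= 32 k, and a counted spine of size S has 2 k S <=
   S^2; these give the constants 64 and 32. *)
have : #|branch k g v| <= #|deep k (unspine g v)| +
    (if k.*2 <= #|spine g v| then #|spine g v| else 0).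
  apply: leq_trans (leq_card_setU _ _) _; rewrite leq_add2l.
  by case: ifP; rewrite ?cards0.
rewrite (spine_fixpts _ pg) -!addnn; set S := #|fixpts _|; set D := #|deep _ _|.
by case: ifP => [kS|_]; nia.
Qed.

(** * Lipschitz property and certificates *)

Lemma path_system_prefix b m ss : all (fun s => size s <= m) ss ->
    b < size (flatten ss) ->
  exists i, b < size (flatten (take i ss)) <= b + m.
Proof.
elim: ss b => //= s ss IH b /andP[sm al]; rewrite size_cat => lt.
have [bs|sb] := ltnP b (size s).
  by exists 1; rewrite /= take0 /= cats0 bs; lia.
have [|i /andP[lt1 le1]] := IH (b - size s) al; first by lia.
by exists i.+1; rewrite /= size_cat; apply/andP; split; lia.
Qed.

Lemma flatten_filter_subseq (a : pred (seq V)) ss :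
  subseq (flatten (filter a ss)) (flatten ss).
Proof.
elim: ss => //= s ss IH; case: ifP => _ /=; first exact: cat_subseq.
exact: subseq_trans IH (suffix_subseq _ _).
Qed.

(** The paths on which f and f' agree at every vertex survive in f'. Each of the others contains a
    disagreement and costs at most 2 l + 1 vertices. *)
Lemma cov_fedges_lipschitz f f' l ss :
  path_system (fedges f) l ss -> all (fun s => size s <= l.*2.+1) ss ->
  size (flatten ss) <=
    cov l (fedges f') + l.*2.+1 * count (fun x => f x != f' x) (flatten ss).
Proof.
rewrite path_systemE => /andP[al us] szs.
pose ss' := filter (all (fun x => f x == f' x)) ss.
have ps : path_system (fedges f') l ss'.
  rewrite path_systemE; apply/andP; split; last first.
    by apply: subseq_uniq us; apply: flatten_filter_subseq.
  apply/allP => s; rewrite mem_filter => /andP[ff' sin].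
  have /andP[-> srt] := allP al s sin; move: srt; case: s ff' {sin} => //= x s.
  elim: s x => //= y s IH x /and3P[xx yy ss1] /andP[xy ys].
  rewrite IH /= ?yy ?andbT //; move: xy.
  by rewrite !adj_fedges (eqP xx) (eqP yy).
apply: leq_trans (leq_add (path_system_cov ps) (leqnn _)).
clear ps us; rewrite {}/ss'; elim: ss al szs => //= s ss IH /andP[_ al] /andP[sz szs].
rewrite count_cat size_cat; case: (boolP (all _ s)) => [_|ne] /=.
  by rewrite size_cat mulnDr; have := IH al szs; lia.
have : 0 < count (fun x => f x != f' x) s.
  by rewrite -has_count; move: ne; rewrite -has_predC.
by have := IH al szs; nia.
Qed.

(** Only as many paths are kept as are required to exceed b. The resulting upper bound on the size
    of W controls the norm of the weights in Talagrand's inequality. *)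
Lemma cov_certificate f l b : b < cov l (fedges f) ->
  exists W : {set V}, b < #|W| <= b + l.*2.+1 /\
    forall f', #|W| <= cov l (fedges f') + l.*2.+1 * #|[set x in W | f x != f' x]|.
Proof.
have [ss [ps -> al]] := cov_witness (fedges f) l => lt.
have [i bounds] := path_system_prefix al lt.
have al' : all (fun s => size s <= l.*2.+1) (take i ss).
  by apply/allP => s /mem_take/(allP al).
have ps' : path_system (fedges f) l (take i ss).
  move: ps; rewrite !path_systemE => /andP[al1 us].
  rewrite -[ss in all _ ss](cat_take_drop i) all_cat in al1.
  rewrite -[ss](cat_take_drop i) flatten_cat cat_uniq in us.
  by case/andP: al1 => -> _; case/andP: us.
have us : uniq (flatten (take i ss)) by move: ps'; rewrite path_systemE => /andP[].
exists (covered (take i ss)); rewrite covered_card //; split=> // f'.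
apply: leq_trans (cov_fedges_lipschitz f' ps' al') _.
rewrite leq_add2l leq_mul // -size_filter -(card_uniqP (filter_uniq _ us)).
by apply: subset_leq_card; apply/subsetP => x; rewrite mem_filter !inE andbC.
Qed.

End PathSystems.

(** * Cyclic points and coalescence in functions *)

Lemma sum_card_dep (I J : finType) (P : I -> pred J) :
  \sum_i #|[set j | P i j]| = #|[set p : I * J | P p.1 p.2]|.
Proof.
rewrite -[RHS]sum1_card (eq_bigl (fun p : I * J => P p.1 p.2)); last first.
  by move=> p; rewrite inE.
rewrite -(pair_big_dep predT P (fun _ _ => 1)) /=; apply: eq_bigr => i _.
by rewrite -sum1_card; apply: eq_bigl => j; rewrite inE.
Qed.

Lemma card_union_bound (I T : finType) (A : {set T}) (B : I -> {set T}) :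
  (forall x, x \in A -> exists i, x \in B i) -> #|A| <= \sum_i #|B i|.
Proof.
move=> AB; under eq_bigr do rewrite -sum1_card big_mkcond /=.
rewrite exchange_big /= -sum1_card big_mkcond /=; apply: leq_sum => x _.
case: ifP => // /AB[i xi]; rewrite (bigD1 i) //= xi; exact: leq_addr.
Qed.

Lemma sqr_sum_le (I : finType) (B : {set I}) (c : I -> nat) :
  (\sum_(b in B) c b) ^ 2 <= #|B| * \sum_(b in B) c b ^ 2.
Proof.
rewrite -(leq_pmul2l (isT : 0 < 2)) -[X in 2 * X <= _]mulnn big_distrlr /=.
have -> : 2 * (#|B| * \sum_(b in B) c b ^ 2) =
    \sum_(b in B) \sum_(b' in B) (c b ^ 2 + c b' ^ 2).
  transitivity (\sum_(b in B) (#|B| * c b ^ 2 + \sum_(b' in B) c b' ^ 2)).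
    by rewrite big_split /= -big_distrr sum_nat_const /= addnn mul2n.
  by apply: eq_bigr => b _; rewrite big_split /= sum_nat_const.
rewrite big_distrr /=; apply: leq_sum => b _; rewrite big_distrr /=; apply: leq_sum => b' _.
by case: (nat_Cauchy (c b) (c b')).
Qed.

Section Counting.

Variable V : finType.
Implicit Types (f g h : {ffun V -> V}) (x y z r v w : V).

Lemma orbit_unique f x s : uniq s -> 0 < size s ->
  (forall i, i < size s -> iter i f x = nth x s i) ->
  (forall z, z \in s -> f z \in s) -> orbit f x = s.
Proof.
move=> us s0 its fs.
have xs : x \in s by rewrite -[x]/(iter 0 f x) its // mem_nth.
have sz : order f x = size s.
  rewrite /order -(card_uniqP us); apply: eq_card => z; apply/idP/idP.
    by move/iter_findex <-; elim: (findex f x z) => //= n; apply: fs.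
  by move=> zs; rewrite -(nth_index x zs) -its ?index_mem //; apply: fconnect_iter.
apply: (@eq_from_nth _ x); rewrite size_orbit // => i lti.
by rewrite nth_traject // its // -sz.
Qed.

Lemma iter_upd f a y i w : (forall j, j < i -> iter j f w != a) ->
  iter i (upd f a y) w = iter i f w.
Proof.
elim: i => //= i IH ne; rewrite IH => [|j ji]; last by apply: ne; apply: ltnW.
by rewrite ffunE (negbTE (ne i _)).
Qed.

Lemma upd_upd f a y y' : upd (upd f a y) a y' = upd f a y'.
Proof. by apply/ffunP => z; rewrite !ffunE; case: eqP. Qed.

Lemma upd_id f a : upd f a (f a) = f.
Proof. by apply/ffunP => z; rewrite !ffunE; case: eqP => // ->. Qed.

Lemma updx f a y : upd f a y a = y.
Proof. by rewrite ffunE eqxx. Qed.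

(** * Redirecting the last point of an orbit *)

Definition orbit_end f x := iter (order f x).-1 f x.

Lemma iter_orbit_inj f x i j : i < order f x -> j < order f x ->
  iter i f x = iter j f x -> i = j.
Proof.
move=> lti ltj; rewrite -(nth_traject f lti x) -(nth_traject f ltj x) => /eqP.
by rewrite nth_uniq ?size_traject ?orbit_uniq // => /eqP.
Qed.

Lemma orbit_iterP f x z : z \in orbit f x -> exists2 i, i < order f x & z = iter i f x.
Proof. by move/trajectP. Qed.

(** The orbit of x has the shape of the letter rho, and the image of its last point says where it
    closes. Moving that image within the orbit changes neither the orbit nor its end, so the move
    can be undone; the two counting lemmas below rest on this. *)
Lemma orbit_redirect f x y : y \in orbit f x -> orbit (upd f (orbit_end f x) y) x = orbit f x.
Proof.
move=> yo; set e := orbit_end f x; have n0 := order_gt0 f x.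
apply: orbit_unique => [|||z zo]; rewrite ?orbit_uniq ?size_orbit //.
  move=> i lti; rewrite nth_traject // iter_upd // => j ji.
  apply/eqP => /iter_orbit_inj E; have : j = (order f x).-1 by apply: E; lia.
  by lia.
rewrite ffunE; case: ifP => // _; move: zo; rewrite -!fconnect_orbit => zo.
exact: connect_trans zo (fconnect1 _ _).
Qed.

Lemma orbit_end_redirect f x y : y \in orbit f x ->
  orbit_end (upd f (orbit_end f x) y) x = orbit_end f x.
Proof.
move=> yo; have E := orbit_redirect yo.
have En : order (upd f (orbit_end f x) y) x = order f x.
  by rewrite -!size_orbit E.
have ltn : (order f x).-1 < order f x by rewrite prednK // order_gt0.
rewrite {1}/orbit_end En.
have ltn' : (order f x).-1 < order (upd f (orbit_end f x) y) x by rewrite En.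
by move/(congr1 (fun s => nth x s (order f x).-1)): E; rewrite /orbit !nth_traject.
Qed.

Lemma iter_redirect f x y i : y \in orbit f x -> i < order f x ->
  iter i (upd f (orbit_end f x) y) x = iter i f x.
Proof.
move=> yo lti; have E := orbit_redirect yo.
have lti' : i < order (upd f (orbit_end f x) y) x by rewrite -size_orbit E size_orbit.
by move/(congr1 (fun s => nth x s i)): E; rewrite /orbit !nth_traject.
Qed.

Definition tail_length i f w :=
  cyc f (iter i f w) && [forall j : 'I_i, ~~ cyc f (iter j f w)].

Lemma tail_length_order f w i : tail_length i f w -> i < order f w.
Proof.
case/andP=> _ /forallP nc; rewrite ltnNge; apply/negP => le.
have : iter (order f w) f w \in orbit f w by rewrite -fconnect_orbit fconnect_iter.
case/orbit_iterP => k ltk E.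
have /negP[] := nc (Ordinal (leq_trans ltk le)); rewrite /=.
apply: (@period_cyc _ _ _ (order f w - k).-1).
by rewrite prednK ?subn_gt0 // -iterD subnK // ltnW.
Qed.

(** The orbit closes at its first cyclic point: earlier points are not cyclic, and closing later
    would give two distinct cyclic points with the same image. *)
Lemma orbit_end_next f w i : tail_length i f w -> f (orbit_end f w) = iter i f w.
Proof.
move=> tl; have lti := tail_length_order tl; case/andP: tl => ci /forallP nc.
rewrite /orbit_end -iterS prednK ?order_gt0 //.
have : iter (order f w) f w \in orbit f w by rewrite -fconnect_orbit fconnect_iter.
case/orbit_iterP => k ltk E; rewrite E; congr (iter _ f w).
have ck : cyc f (iter k f w).
  apply: (@period_cyc _ _ _ (order f w - k).-1).
  by rewrite prednK ?subn_gt0 // -iterD subnK // ltnW.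
case: (ltngtP k i) => // [ki|ik]; first by have /negP := nc (Ordinal ki).
have cge j : i <= j -> cyc f (iter j f w).
  by move=> ij; rewrite -(subnK ij) iterD; apply: cyc_iter.
have n0 := order_gt0 f w.
have k0 : 0 < k by apply: leq_ltn_trans ik.
have /iter_orbit_inj : iter k.-1 f w = iter (order f w).-1 f w.
  apply: (@cyc_inj _ f); try (apply: cge; lia).
  by rewrite -!iterS !prednK.
by move=> H; have := H _ _; lia.
Qed.

Lemma tail_length0 f w : tail_length 0 f w = cyc f w.
Proof. by rewrite /tail_length /=; apply/andb_idr => _; apply/forallP => -[]. Qed.

Lemma card_pairs : #|{: {ffun V -> V} * V}| = #|V| * #|V| ^ #|V|.
Proof. by rewrite card_prod card_ffun mulnC. Qed.

(** The end of the orbit of x is redirected from x to y, and y is forgotten. It is recovered as the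
    new image of the end, and f by redirecting the end back to x. *)
Lemma card_same_cycle :
  #|[set p : {ffun V -> V} * V * V | cyc p.1.1 p.1.2 && (p.2 \in orbit p.1.1 p.1.2)]|
  <= #|V| * #|V| ^ #|V|.
Proof.
rewrite -card_pairs -cardsT.
pose F (p : {ffun V -> V} * V * V) := (upd p.1.1 (orbit_end p.1.1 p.1.2) p.2, p.1.2).
pose e (q : {ffun V -> V} * V) := orbit_end q.1 q.2.
pose F' q := (upd q.1 (e q) q.2, q.2, q.1 (e q)).
rewrite -(@card_in_imset _ _ F); first exact: subset_leq_card.
apply: (@can_in_inj _ _ _ _ F') => -[[f x] y]; rewrite inE /= => /andP[cx yo].
rewrite /F /F' /e /= orbit_end_redirect // upd_upd updx; congr (_, _, _).
by have := upd_id f (orbit_end f x); rewrite (@orbit_end_next _ _ 0) // tail_length0.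
Qed.

(** Redirecting the end of the orbit to w makes w cyclic. For known i this is undone by sending the
    end back to the i-th point. *)
Lemma card_tail_length i :
  #|[set p : {ffun V -> V} * V | tail_length i p.1 p.2]|
  <= #|[set p : {ffun V -> V} * V | cyc p.1 p.2]|.
Proof.
pose F (p : {ffun V -> V} * V) := (upd p.1 (orbit_end p.1 p.2) p.2, p.2).
pose e (q : {ffun V -> V} * V) := orbit_end q.1 q.2.
pose F' q := (upd q.1 (e q) (iter i q.1 q.2), q.2).
rewrite -(@card_in_imset _ _ F).
  apply/subset_leq_card/subsetP => q /imsetP[[f w] + ->]; rewrite inE /= => tl.
  have wo : w \in orbit f w by rewrite -fconnect_orbit connect0.
  rewrite inE /=; apply: (@period_cyc _ _ _ (order f w).-1).
  by rewrite iterS iter_redirect ?updx // prednK // order_gt0.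
apply: (@can_in_inj _ _ _ _ F') => -[f w]; rewrite inE /= => tl.
have wo : w \in orbit f w by rewrite -fconnect_orbit connect0.
rewrite /F /F' /e /= orbit_end_redirect // upd_upd iter_redirect ?tail_length_order //.
by congr pair; have := upd_id f (orbit_end f w); rewrite (orbit_end_next tl).
Qed.

Lemma fconnect_agree f f' a b : fconnect f a b ->
  (forall z, fconnect f a z -> z != b -> f' z = f z) -> fconnect f' a b.
Proof.
move/iter_findex; move: (findex f a b) => n; elim: n a => [|n IH] a.
  by move=> /= -> _; apply: connect0.
rewrite iterSr => E agree; have [->|ab] := eqVneq a b; first exact: connect0.
apply: connect_trans (fconnect1 _ _) _; rewrite agree ?connect0 //.
apply: IH => // z az; apply: agree; exact: connect_trans (fconnect1 _ _) az.
Qed.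

Lemma card_different_cycles :
  #|[set p : {ffun V -> V} * V * V |
      [&& cyc p.1.1 p.1.2, cyc p.1.1 p.2 & p.2 \notin orbit p.1.1 p.1.2]]|
  <= #|[set p : {ffun V -> V} * V * V | cyc p.1.1 p.1.2 && (p.2 \in orbit p.1.1 p.1.2)]|.
Proof.
pose F (p : {ffun V -> V} * V * V) :=
  ([ffun z => p.1.1 (tperm p.1.2 p.2 z)] : {ffun V -> V}, p.1.2, p.2).
have FK : involutive F.
  move=> [[f x] y]; rewrite /F /=; congr (_, _, _); apply/ffunP => z.
  by rewrite !ffunE tpermK.
rewrite -(card_imset _ (inv_inj FK)).
apply/subset_leq_card/subsetP => q /imsetP[[[f x] y] + ->]; rewrite !inE /= => /and3P[cx cy ny].
set f' := [ffun z => _]; rewrite -fconnect_orbit in ny; rewrite -fconnect_orbit.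
have f'x : f' x = f y by rewrite ffunE tpermL.
have f'y : f' y = f x by rewrite ffunE tpermR.
have f'z z : z != x -> z != y -> f' z = f z.
  by move=> zx zy; rewrite ffunE tpermD // eq_sym.
have yy : fconnect f' (f y) y.
  apply: (fconnect_agree cy) => z yz zy; apply: f'z => //.
  apply: contraNneq ny => zx; rewrite zx in yz; apply: (cyc_fconnect cy).
  exact: connect_trans (fconnect1 _ _) yz.
have xx : fconnect f' (f x) x.
  apply: (fconnect_agree cx) => z xz zx; apply: f'z => //.
  apply: contraNneq ny => zy; rewrite zy in xz.
  exact: connect_trans (fconnect1 _ _) xz.
have xy : fconnect f' (f' x) y by rewrite f'x.
apply/andP; split; last exact: connect_trans (fconnect1 _ _) xy.
by apply: connect_trans xy _; rewrite fconnect_step f'y xx orbT.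
Qed.

(* Swapping the images of two cyclic points on different cycles merges these
   cycles, so that pairs on different cycles are at most as many as pairs on
   the same cycle. *)
Lemma sum_sqr_cyc :
  \sum_(f : {ffun V -> V}) #|fixpts (tie f)| ^ 2 <= 2 * #|V| * #|V| ^ #|V|.
Proof.
have -> : \sum_(f : {ffun V -> V}) #|fixpts (tie f)| ^ 2 =
    #|[set p : {ffun V -> V} * V * V | cyc p.1.1 p.1.2 && cyc p.1.1 p.2]|.
  transitivity (\sum_(f : {ffun V -> V}) \sum_(x : V) #|[set y | cyc f x && cyc f y]|).
    apply: eq_bigr => f _; rewrite -mulnn -sum_nat_const big_mkcond /=.
    apply: eq_bigr => x _; rewrite fixpts_tie; case: ifP => _.
      by apply: eq_card => y; rewrite fixpts_tie inE.
    by apply/esym/eq_card0 => y; rewrite inE.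
  by rewrite pair_big /= (sum_card_dep (fun p y => cyc p.1 p.2 && cyc p.1 y)).
apply: (@leq_trans (2 * (#|V| * #|V| ^ #|V|))); last by rewrite mulnA.
rewrite mul2n -addnn.
apply: leq_trans (leq_add card_same_cycle (leq_trans card_different_cycles card_same_cycle)).
apply: leq_trans (leq_card_setU _ _); apply/subset_leq_card/subsetP => p.
by rewrite !inE => /andP[-> ->] /=; case: (_ \in _).
Qed.

Lemma card_cyc :
  #|[set p : {ffun V -> V} * V | cyc p.1 p.2]| ^ 2 <=
  2 * #|V| * (#|V| ^ #|V|) ^ 2.
Proof.
rewrite -sum_card_dep.
have E f : #|[set x | cyc f x]| = #|fixpts (tie f)|.
  by apply: eq_card => x; rewrite fixpts_tie inE.
under eq_bigr do rewrite E.
have := sqr_sum_le [set: {ffun V -> V}] (fun f => #|fixpts (tie f)|).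
rewrite cardsT card_ffun; under eq_bigl do rewrite inE.
under [X in _ <= _ * X]eq_bigl do rewrite inE.
move/leq_trans; apply; rewrite [X in _ <= X]mulnC -mulnn -mulnA leq_mul //.
by rewrite mulnC; apply: sum_sqr_cyc.
Qed.

Lemma card_iter_cyc k :
  #|[set p : {ffun V -> V} * V | cyc p.1 (iter k p.1 p.2)]| <=
  k.+1 * #|[set p : {ffun V -> V} * V | cyc p.1 p.2]|.
Proof.
have -> : k.+1 * #|[set p : {ffun V -> V} * V | cyc p.1 p.2]| =
    \sum_(i < k.+1) #|[set p : {ffun V -> V} * V | cyc p.1 p.2]|.
  by rewrite sum_nat_const card_ord.
apply: (@leq_trans (\sum_(i < k.+1) #|[set p : {ffun V -> V} * V | tail_length i p.1 p.2]|));
  last by apply: leq_sum => i _; apply: card_tail_length.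
apply: card_union_bound => -[f w]; rewrite inE /= => ck.
have ex : exists j, cyc f (iter j f w) by exists k.
case: (ex_minnP ex) => i ci min; have ik : i < k.+1 by rewrite ltnS min.
exists (Ordinal ik); rewrite inE /tail_length /= ci; apply/forallP => j.
by apply/negP => /min; rewrite leqNgt ltn_ord.
Qed.

(** When the trajectories of w and w' merge at step i + 1, the image of the i-th point of w' is
    forced, which saves a factor t. The injection replaces that image by an arbitrary y. Neither
    trajectory visits the modified point before step i, for otherwise a point assumed noncyclic
    would be cyclic, so everything can be read back. *)
Lemma coalescence_bound k i : i < k ->
  #|V| * #|[set p : {ffun V -> V} * V * V |
    [&& ~~ cyc p.1.1 (iter k p.1.1 p.1.2), ~~ cyc p.1.1 (iter k p.1.1 p.2),
      iter i p.1.1 p.1.2 != iter i p.1.1 p.2 &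
      iter i.+1 p.1.1 p.1.2 == iter i.+1 p.1.1 p.2]]|
  <= #|V| ^ #|V| * #|V| * #|V|.
Proof.
move=> ik; set B := finset _; rewrite mulnC -[X in _ * X]cardsT -cardsX.
have -> : #|V| ^ #|V| * #|V| * #|V| = #|{: {ffun V -> V} * V * V}|.
  by rewrite !card_prod card_ffun.
pose F (q : {ffun V -> V} * V * V * V) :=
  (upd q.1.1.1 (iter i q.1.1.1 q.1.2) q.2, q.1.1.2, q.1.2).
pose a' (p : {ffun V -> V} * V * V) := iter i p.1.1 p.2.
pose F' p := (upd p.1.1 (a' p) (p.1.1 (iter i p.1.1 p.1.2)), p.1.2, p.2, p.1.1 (a' p)).
rewrite -(@card_in_imset _ _ F); first exact: max_card.
apply: (@can_in_inj _ _ _ _ F') => -[[[f w] w'] y]; rewrite !inE /= andbT.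
case/and4P=> ncw ncw' ne /eqP eq.
have ncj x j : ~~ cyc f (iter k f x) -> j <= k -> ~~ cyc f (iter j f x).
  by move=> nc jk; apply: noncyc_prefix jk nc.
have E1 : iter i (upd f (iter i f w') y) w = iter i f w.
  apply: iter_upd => j ji; apply: contraNneq (ncj w j.+1 ncw _) => [E|]; last by lia.
  apply: (@period_cyc _ _ _ (i - j).-1); rewrite prednK ?subn_gt0 //.
  rewrite -iterD addnS subnK; last exact: ltnW.
  by rewrite !iterS eq E.
have E2 : iter i (upd f (iter i f w') y) w' = iter i f w'.
  apply: iter_upd => j ji; apply: contraNneq (ncj w' j ncw' _) => [E|]; last by lia.
  apply: (@period_cyc _ _ _ (i - j).-1); rewrite prednK ?subn_gt0 //.
  by rewrite -iterD subnK // ltnW.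
rewrite /F' /a' /F /= E1 E2 updx upd_upd; congr (_, _, _, _).
by rewrite ffunE (negbTE ne) eq upd_id.
Qed.

Lemma card_meeting k :
  #|[set p : {ffun V -> V} * V * V |
     ~~ cyc p.1.1 (iter k p.1.1 p.1.2) && (iter k p.1.1 p.1.2 == iter k p.1.1 p.2)]|
  <= k.+1 * (#|V| * #|V| ^ #|V|).
Proof.
have [V0|V0] := posnP #|V|.
  by apply: leq_trans (max_card _) _; rewrite !card_prod V0 !muln0.
(* A class i < k holds the triples that merge at time i + 1; the last class holds those with w =
   w'. *)
pose B (i : 'I_k.+1) := if i == ord_max then
    [set p : {ffun V -> V} * V * V | p.1.2 == p.2] else
  [set p : {ffun V -> V} * V * V |
    [&& ~~ cyc p.1.1 (iter k p.1.1 p.1.2), ~~ cyc p.1.1 (iter k p.1.1 p.2),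
      iter i p.1.1 p.1.2 != iter i p.1.1 p.2 &
      iter i.+1 p.1.1 p.1.2 == iter i.+1 p.1.1 p.2]].
apply: (@leq_trans (\sum_i #|B i|)); last first.
  have -> : k.+1 * (#|V| * #|V| ^ #|V|) = \sum_(i < k.+1) (#|V| * #|V| ^ #|V|).
    by rewrite sum_nat_const card_ord.
  apply: leq_sum => i _; rewrite /B; case: eqVneq => [_|ne]; last first.
    have ik : i < k.
      by rewrite ltn_neqAle -ltnS ltn_ord andbT; move: ne; rewrite -val_eqE.
    rewrite -(leq_pmul2l V0); apply: leq_trans (coalescence_bound ik) _.
    by rewrite mulnC leq_mul // mulnC.
  have <- : #|[set: {ffun V -> V} * V]| = #|V| * #|V| ^ #|V| by rewrite cardsT card_pairs.
  rewrite -(@card_in_imset _ _ fst); first exact: subset_leq_card.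
  by move=> [[f w] w'] [[g v] v']; rewrite !inE /= => /eqP <- /eqP <- [-> ->].
apply: card_union_bound => -[[f w] w']; rewrite inE /= => /andP[nc /eqP E].
have [<-|ww'] := eqVneq w w'; first by exists ord_max; rewrite /B eqxx inE.
have ex : exists j, iter j f w == iter j f w' by exists k; rewrite E.
case: (ex_minnP ex) => -[|i] /eqP Ei min; first by case/eqP: ww'; apply: Ei.
have ik : i < k by apply: min; rewrite E.
exists (Ordinal (ltnW ik : i < k.+1)); rewrite /B -val_eqE /= ltn_eqF // inE /= nc -E nc /=.
rewrite -!iterS Ei eqxx andbT; apply/negP => /min; lia.
Qed.

(** Second moment method for c (f, v), the number of w with iter k f w = v, over the deep pairs.
    With N = t^t its sum is at least t N / 2, the sum of its squares is at most (k + 1) t N by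
    [card_meeting], and Cauchy-Schwarz bounds the number of pairs from below. *)
Lemma sum_deep_lower k : 8 * k.+1 ^ 2 <= #|V| ->
  #|V| * #|V| ^ #|V| <= 4 * k.+1 * \sum_(f : {ffun V -> V}) #|deep k f|.
Proof.
move=> kV; have V0 : 0 < #|V| by apply: leq_trans kV.
rewrite sum_card_dep; set B := finset _; set D := #|B|.
set N := #|V| ^ #|V|; have N0 : 0 < N by rewrite expn_gt0 V0.
pose c (p : {ffun V -> V} * V) := #|[set w | iter k p.1 w == p.2]|.
have sumc : \sum_(p in B) c p =
    #|[set p : {ffun V -> V} * V | ~~ cyc p.1 (iter k p.1 p.2)]|.
  rewrite -sum1_card [RHS](partition_big (fun q : {ffun V -> V} * V => (q.1, iter k q.1 q.2)) [in B]) /=; last first.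
    move=> [f w]; rewrite !inE /= => ->; apply/existsP; exists w; exact: eqxx.
  apply: eq_bigr => -[f v]; rewrite inE /= => /andP[ncv _].
  have injF : injective (fun w : V => (f, w)) by move=> ? ? [].
  rewrite sum1_card /c -(card_imset _ injF); apply: eq_card => q.
  apply/imsetP/idP => [[w + ->]|].
    by rewrite inE /= => /eqP Ew; rewrite unfold_in /= inE /= Ew ncv eqxx.
  rewrite unfold_in /= inE => /andP[ncq /eqP[<- E]].
  by exists q.2; rewrite ?inE ?E; case: q {ncq E}.
have sumc2 : \sum_(p in B) c p ^ 2 <= k.+1 * (#|V| * N).
  apply: leq_trans (card_meeting k).
  rewrite -[X in _ <= X]sum1_card.
  rewrite [X in _ <= X](partition_big
      (fun q : {ffun V -> V} * V * V => (q.1.1, iter k q.1.1 q.1.2)) [in B]) /=; last first.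
    move=> [[f w] w']; rewrite !inE /= => /andP[-> _]; apply/existsP; exists w; exact: eqxx.
  apply: leq_sum => -[f v]; rewrite inE /= => /andP[ncv _].
  have injF : injective (fun q : V * V => (f, q.1, q.2)) by move=> [? ?] [? ?] /= [-> ->].
  rewrite sum1_card /c -mulnn -cardsX -(card_imset _ injF).
  apply/subset_leq_card/subsetP => q /imsetP[[w w']]; rewrite !inE /=.
  move=> /andP[/eqP Ew /eqP Ew'] ->; rewrite unfold_in /= inE /= Ew ncv Ew' !eqxx.
  by [].
set X := #|[set p : {ffun V -> V} * V | cyc p.1 p.2]|.
have X2 : X ^ 2 <= 2 * #|V| * N ^ 2 := card_cyc.
have W2 : #|V| * N <= 2 * \sum_(p in B) c p.
  rewrite sumc.
  have := cardsC [set p : {ffun V -> V} * V | cyc p.1 (iter k p.1 p.2)].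
  rewrite card_pairs -/N; have -> : ~: [set p : {ffun V -> V} * V | cyc p.1 (iter k p.1 p.2)]
    = [set p | ~~ cyc p.1 (iter k p.1 p.2)] by apply/setP => p; rewrite !inE.
  have := card_iter_cyc k; rewrite -/X.
  (* As X^2 <= 2 t N^2, the hypothesis 8 (k + 1)^2 <= t is exactly what makes (k + 1) X at most t N
     / 2. *)
  have : 2 * (k.+1 * X) <= #|V| * N by rewrite -leq_sqr; nia.
  move: (#|V| * N) (k.+1 * X) => vn kx le1.
  by set a := #|_|; set b := #|_| => le2 E; lia.
have := sqr_sum_le B c; nia.
Qed.

End Counting.

Import Order.TTheory GRing.Theory Num.Theory.

(** * Heights in a random function *)

Section ReedFrost.

Variables (R : realType) (V : finType) (v0 : V).
Implicit Types (f g : {ffun V -> V}) (U A B : {set V}).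

Definition restr U f : {ffun V -> V} := [ffun x => if x \in U then f x else v0].

(** U is the set of susceptible vertices and A the set of active ones: the infection lives for k
    generations if a chain of k steps inside U leads into A. *)
Definition reach k f U A :=
  [exists w, [forall i : 'I_k, iter i f w \in U] && (iter k f w \in A)].

(** The maps from U to U :|: A are encoded as total functions with the value v0 outside U, so that
    they can be counted by [card_pffun_on]. *)
Definition reaching k U A : {set {ffun V -> V}} :=
  [set f in pffun_on v0 (mem U) (mem (U :|: A)) | reach k f U A].

Lemma restr_pffun_on U A f : (forall x, x \in U -> f x \in A) ->
  restr U f \in pffun_on v0 (mem U) (mem A).
Proof.
move=> fU; apply/pffun_onP; split.
  by apply/supportP => x /negbTE xU; rewrite ffunE xU.
by move=> _ /imageP[x xU ->]; rewrite ffunE xU fU.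
Qed.

Lemma pffun_on_mem U A f x : f \in pffun_on v0 (mem U) (mem A) -> x \in U -> f x \in A.
Proof. by case/pffun_onP=> _ fA xU; apply: fA; apply: image_f. Qed.

Lemma pffun_on_out U A f x : f \in pffun_on v0 (mem U) (mem A) -> x \notin U -> f x = v0.
Proof. by case/pffun_onP=> /supportP fU _ /fU. Qed.

Lemma reach_restr k f U A : reach k (restr U f) U A = reach k f U A.
Proof.
have E w m : (forall i, i < m -> iter i f w \in U) -> iter m (restr U f) w = iter m f w.
  by elim: m => //= m IH inU; rewrite IH ?ffunE ?inU // => i /ltnW; apply: inU.
have E' w m : (forall i, i < m -> iter i (restr U f) w \in U) ->
    iter m (restr U f) w = iter m f w.
  elim: m => //= m IH inU; have Em := IH (fun i im => inU i (ltnW im)).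
  by rewrite Em ffunE -Em inU.
apply/existsP/existsP => -[w /andP[/forallP inU kA]]; exists w; apply/andP; split.
- apply/forallP => i; rewrite -E' => [|j ji]; first exact: inU.
  exact: (inU (Ordinal (ltn_trans ji (ltn_ord i)))).
- by rewrite -E' // => j jk; apply: (inU (Ordinal jk)).
- apply/forallP => i; rewrite E => [|j ji]; first exact: inU.
  exact: (inU (Ordinal (ltn_trans ji (ltn_ord i)))).
- by rewrite E // => j jk; apply: (inU (Ordinal jk)).
Qed.

Definition front U A f := [set x in U | f x \in A].

Lemma reach_front k f U A : [disjoint U & A] -> reach k.+1 f U A ->
  reach k f (U :\: front U A f) (front U A f).
Proof.
move=> dUA /existsP[w /andP[/forallP inU kA]]; apply/existsP; exists w.
have inU' i : i <= k -> iter i f w \in U by move=> ik; apply: (inU (Ordinal (ik : i < k.+1))).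
rewrite inE inU' //= andbC -iterS kA /=; apply/forallP => i.
rewrite !inE inU' 1?ltnW //= andbT; apply/negP => fA.
have := disjointFr dUA (inU' i.+1 (ltn_ord i)).
by rewrite iterS fA.
Qed.

(** Splitting by the next generation B, the preimage of A in U: f maps B into A, and maps the rest
    of U into U, which is (U :\: B) :|: B. The restriction to that rest is an instance of the same
    problem with B active. *)
Lemma card_reaching_le k U A : [disjoint U & A] ->
  #|reaching k.+1 U A| <=
  \sum_(B in powerset U) #|A| ^ #|B| * #|reaching k (U :\: B) B|.
Proof.
move=> dUA; rewrite -sum1_card (partition_big (front U A) [in powerset U]) /=; last first.
  by move=> f _; rewrite inE; apply/subsetP => x; rewrite inE => /andP[].
apply: leq_sum => B; rewrite inE => BU.
have Ec : #|A| ^ #|B| = #|[set f | f \in pffun_on v0 (mem B) (mem A)]|.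
  by rewrite cardsE card_pffun_on.
rewrite sum1_card {}Ec -cardsX.
pose F f := (restr B f, restr (U :\: B) f).
set D := (X in #|X| <= _).
have DP f : f \in D -> [/\ f \in pffun_on v0 (mem U) (mem (U :|: A)),
    reach k.+1 f U A & front U A f = B].
  by rewrite unfold_in /= inE => /andP[/andP[-> ->] /eqP].
rewrite -(@card_in_imset _ _ F).
  apply/subset_leq_card/subsetP => q /imsetP[f /DP[fp fr fB] ->].
  have fBA x : x \in B -> f x \in A by rewrite -fB inE => /andP[].
  have fUB x : x \in U :\: B -> f x \in (U :\: B) :|: B.
    rewrite inE => /andP[xB xU]; have nA : f x \notin A by move: xB; rewrite -fB inE xU.
    have := pffun_on_mem fp xU; rewrite inE (negbTE nA) orbF => fU.
    by rewrite !inE fU andbT orNb.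
  rewrite in_setX /= !in_set !restr_pffun_on //= reach_restr -fB.
  exact: reach_front.
move=> f g /DP[fp _ _] /DP[gp _ _] [/ffunP E1 /ffunP E2]; apply/ffunP => x.
case: (boolP (x \in U)) => xU; last by rewrite (pffun_on_out fp) // (pffun_on_out gp).
case: (boolP (x \in B)) => xB; first by move: (E1 x); rewrite !ffunE xB.
by move: (E2 x); rewrite !ffunE inE xB xU.
Qed.

(** * Generating function bound for the epidemic *)

Local Open Scope ring_scope.

Lemma sum_powerset (U : {set V}) (F : nat -> R) :
  \sum_(B in powerset U) F #|B| = \sum_(i < #|U|.+1) F i *+ 'C(#|U|, i).
Proof.
rewrite (partition_big (fun B : {set V} => inord #|B| : 'I_#|U|.+1) predT) //=.
apply: eq_bigr => i _.
transitivity (\sum_(B in [set B : {set V} | B \subset U & #|B| == i]) F i).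
  rewrite [LHS](eq_bigl [in [set B : {set V} | B \subset U & #|B| == i]]).
    by apply: eq_bigr => B; rewrite inE => /andP[_ /eqP ->].
  move=> B; rewrite !inE; case: (boolP (B \subset U)) => //= BU.
  by rewrite -val_eqE /= inordK // ltnS subset_leq_card.
by rewrite sumr_const cards_draws.
Qed.

(* A lower bound for the probability that a branching process with Poisson(1)
   offspring is extinct at generation k. *)
Definition extinct k : R := k%:R / (k + 4)%:R.

Lemma extinct_ge0 k : 0 <= extinct k.
Proof. by rewrite divr_ge0 ?ler0n. Qed.

Lemma extinct_le1 k : extinct k <= 1.
Proof. by rewrite ler_pdivrMr ?ltr0n ?addn_gt0 ?orbT // mul1r ler_nat leq_addr. Qed.

Lemma expR_half_sqr (p : R) : p <= 2 -> (1 - p / 2) ^+ 2 <= expR (- p).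
Proof.
move=> p2; have -> : - p = 2 * (- (p / 2)) by field.
rewrite expRM_natl; apply: lerXn2r; rewrite ?nnegrE ?expR_ge0 //.
  by lra.
exact: le_trans (expR_ge1Dx _).
Qed.

(** [extinct] is a subsolution of the Poisson recursion q' = exp (q - 1). Bounding the exponential
    below by a square reduces this to (k + 1) (k + 4)^2 <= (k + 5) (k + 2)^2, whose two sides differ
    only in the constant terms 16 and 20. *)
Lemma extinct_step k : extinct k.+1 <= expR (- (1 - extinct k)).
Proof.
apply: le_trans (expR_half_sqr _); last by have := extinct_ge0 k; lra.
have k4 : 0 < (k + 4)%:R :> R by rewrite ltr0n addn_gt0 orbT.
have k0 : 0 <= k%:R :> R by [].
have -> : extinct k.+1 = (k%:R + 1) / (k%:R + 5) by rewrite /extinct natrD -natr1; congr (_ / _); ring.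
have -> : extinct k = k%:R / (k%:R + 4) by rewrite /extinct natrD.
have h5 : (k%:R + 5 : R) != 0 by apply: lt0r_neq0; lra.
have h4 : (k%:R + 4 : R) != 0 by apply: lt0r_neq0; lra.
rewrite ler_pdivrMr; last by lra.
have -> : 1 - (1 - k%:R / (k%:R + 4)) / 2 = (k%:R + 2) / (k%:R + 4) :> R by field.
rewrite expr_div_n mulrAC ler_pdivlMr; last by rewrite exprn_gt0; lra.
nra.
Qed.

Lemma add_le_mul_expR (x a q : R) : 0 < x -> 0 <= a -> 0 <= q -> q <= 1 ->
  x + a <= (x + a * q) * expR (a * (1 - q) / x).
Proof.
move=> x0 a0 q0 q1.
have y0 : 0 < x + a * q by rewrite ltr_wpDr ?mulr_ge0.
apply: (@le_trans _ _ ((x + a * q) * (1 + a * (1 - q) / x))).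
  have -> : (x + a * q) * (1 + a * (1 - q) / x) = x + a + a * q * (a * (1 - q) / x).
    by field; rewrite lt0r_neq0.
  by rewrite lerDl !mulr_ge0 ?invr_ge0 ?subr_ge0 // ltW.
by rewrite ler_pM2l // expR_ge1Dx.
Qed.

(* The number of infected among u susceptible given a active individuals is
   binomial (u, a / (u + a)); its probability generating function is dominated
   by that of a Poisson variable of mean a. *)
Lemma binomial_pgf_ge (u a : nat) (q : R) : 0 <= q <= 1 ->
  (u%:R + a%:R) ^+ u * expR (- (1 - q)) ^+ a <= (u%:R + a%:R * q) ^+ u.
Proof.
move=> /andP[q0 q1]; case: u => [|u].
  rewrite !expr0 mul1r exprn_ile1 ?expR_ge0 // expR_le1; lra.
set x : R := u.+1%:R; have x0 : 0 < x by rewrite ltr0n.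
have a0 : 0 <= a%:R :> R by [].
have y0 : 0 < x + a%:R * q by rewrite ltr_wpDr ?mulr_ge0.
rewrite -expRM_natl mulrN expRN ler_pdivrMr ?expR_gt0 //.
have le1 := add_le_mul_expR x0 a0 q0 q1.
apply: le_trans (lerXn2r _ _ _ le1) _; rewrite ?nnegrE ?addr_ge0 ?mulr_ge0 ?expR_ge0 ?(ltW x0) ?(ltW y0) //.
by rewrite exprMn -expRM_natl -/x mulrCA divff ?mulr1 // lt0r_neq0.
Qed.

(** Among the (u + a)^u maps, summing q^|B| over the next generation B gives (u + a q)^u by the
    binomial theorem, with q = [extinct k]. By [binomial_pgf_ge] and [extinct_step], this is at
    least (u + a)^u ([extinct k.+1])^a. *)
Lemma card_reaching_bound k U A : [disjoint U & A] ->
  #|reaching k U A|%:R <= (#|U| + #|A|)%:R ^+ #|U| * (1 - extinct k ^+ #|A|).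
Proof.
elim: k U A => [|k IH] U A dUA.
  have cUA : #|U :|: A| = (#|U| + #|A|)%N.
    by rewrite cardsU disjoint_setI0 // cards0 subn0.
  (* As [extinct 0] is 0, the bound is 0 for empty A, where 0 ^ 0 = 1, and the number of all maps
     otherwise. *)
  rewrite /extinct mul0r expr0n; case: eqVneq => [/eqP|_]; rewrite /= ?subrr ?mulr0 ?subr0 ?mulr1.
    rewrite cards_eq0 => /eqP ->; rewrite eq_card0 // => f; rewrite !inE.
    by apply/negP => /andP[_ /existsP[w]]; rewrite inE andbF.
  rewrite -natrX ler_nat -cUA -(card_pffun_on v0).
  by apply/subset_leq_card/subsetP => f; rewrite inE => /andP[].
apply: (@le_trans _ _ (\sum_(B in powerset U)
    (#|A|%:R ^+ #|B| * #|U|%:R ^+ (#|U| - #|B|) * (1 - extinct k ^+ #|B|)))).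
  have := card_reaching_le k dUA; rewrite -(ler_nat R) natr_sum => /le_trans; apply.
  apply: ler_sum => B; rewrite inE => BU; rewrite natrM natrX -mulrA.
  rewrite ler_wpM2l ?exprn_ge0 //.
  have -> : (#|U| - #|B|)%N = #|U :\: B| by rewrite cardsDS.
  have -> : #|U| = (#|U :\: B| + #|B|)%N by rewrite cardsDS // subnK ?subset_leq_card.
  by apply: IH; rewrite -setI_eq0 setDE -setIA [~: B :&: B]setIC setICr setI0.
rewrite (sum_powerset U (fun b => #|A|%:R ^+ b * #|U|%:R ^+ (#|U| - b) * (1 - extinct k ^+ b))).
have -> : \sum_(i < #|U|.+1)
    (#|A|%:R ^+ i * #|U|%:R ^+ (#|U| - i) * (1 - extinct k ^+ i)) *+ 'C(#|U|, i) =
  (#|U|%:R + #|A|%:R) ^+ #|U| - (#|U|%:R + #|A|%:R * extinct k) ^+ #|U|.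
  rewrite !exprDn -sumrB; apply: eq_bigr => i _.
  rewrite -mulrnBl; congr (_ *+ _); rewrite [(_ * extinct k) ^+ i]exprMn.
  by move: (#|A|%:R ^+ i) (#|U|%:R ^+ (#|U| - i)) (extinct k ^+ i) => x y z; ring.
rewrite natrD mulrBr mulr1 lerD2l lerN2.
apply: le_trans (binomial_pgf_ge _ _ _); last by rewrite extinct_ge0 extinct_le1.
rewrite ler_wpM2l ?exprn_ge0 ?addr_ge0 //.
by rewrite lerXn2r ?nnegrE ?extinct_ge0 ?expR_ge0 ?extinct_step.
Qed.


(** The epidemic starts from A = {v} with all other vertices susceptible. The value f v is free, and
    a chain into a noncyclic v cannot pass through v earlier. *)
Lemma card_deep_point k (v : V) :
  #|[set f | v \in deep k f]|%:R <= #|V|%:R ^+ #|V| * (4 / (k + 4)%:R) :> R.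
Proof.
pose F f := (f v, restr [set~ v] f).
have V0 : (0 < #|V|)%N by apply/card_gt0P; exists v.
have dv : [disjoint [set~ v] & [set v]] by rewrite disjoint_sym disjoints1 !inE eqxx.
have le : (#|[set f | v \in deep k f]| <= #|V| * #|reaching k [set~ v] [set v]|)%N.
  rewrite -[X in (X * _)%N]cardsT -cardsX -(@card_in_imset _ _ F).
    apply/subset_leq_card/subsetP => q /imsetP[f + ->].
    rewrite inE => /deepP[ncv [w Ew]]; rewrite in_setX in_setT in_set restr_pffun_on /=.
      rewrite reach_restr; apply/existsP; exists w; rewrite !inE Ew eqxx andbT.
      apply/forallP => i; rewrite !inE; apply: contraNneq ncv => Ei.
      apply: (@period_cyc _ _ _ (k - i).-1); rewrite prednK ?subn_gt0 //.
      by rewrite -{1}Ei -iterD subnK // ltnW.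
    by move=> x _; rewrite !inE orNb.
  move=> f g _ _ [Ev /ffunP E]; apply/ffunP => x; have [->//|xv] := eqVneq x v.
  by move: (E x); rewrite !ffunE !inE xv.
move: le; rewrite -(ler_nat R) => /le_trans; apply.
have cU : #|[set~ v]| = #|V|.-1 by rewrite cardsC1.
have := card_reaching_bound k dv; rewrite cU cards1 addn1 prednK // expr1 => le.
rewrite natrM; apply: le_trans (ler_wpM2l (ler0n _ _) le) _.
have -> : #|V|%:R ^+ #|V| = #|V|%:R * #|V|%:R ^+ #|V|.-1 :> R by rewrite -exprS prednK.
rewrite -mulrA !ler_wpM2l ?exprn_ge0 //.
have k4 : (k%:R + 4 : R) != 0 by apply: lt0r_neq0; rewrite ltr_wpDl.
by rewrite /extinct natrD le_eqVlt; apply/orP; left; apply/eqP; field.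
Qed.

Lemma sum_deep_upper k :
  (\sum_(f : {ffun V -> V}) #|deep k f|)%:R <=
    #|V|%:R * #|V|%:R ^+ #|V| * (4 / (k + 4)%:R) :> R.
Proof.
have -> : (\sum_(f : {ffun V -> V}) #|deep k f| = \sum_(v : V) #|[set f | v \in deep k f]|)%N.
  transitivity (\sum_(f : {ffun V -> V}) \sum_(v | v \in deep k f) 1)%N.
    by apply: eq_bigr => f _; rewrite sum1_card.
  rewrite (exchange_big_dep predT) //=; apply: eq_bigr => v _.
  by rewrite -sum1_card; apply: eq_bigl => f; rewrite inE.
rewrite natr_sum -mulrA mulr_natl -sumr_const (eq_bigl [in V]) //.
by apply: ler_sum => v _; apply: card_deep_point.
Qed.

End ReedFrost.

(** * Talagrand's inequality *)

Section Talagrand.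

Local Open Scope ring_scope.

Variable R : realType.

Lemma expR_le_inv (w : R) : w < 1 -> expR w <= (1 - w)^-1.
Proof.
move=> w1; have w0 : 0 < 1 - w by rewrite subr_gt0.
rewrite -[w in expR w]opprK expRN lef_pV2 ?posrE ?expR_gt0 //.
by have := expR_ge1Dx (- w).
Qed.

Lemma talagrand_exponent (y : R) : 0 <= y -> exists theta : R,
  0 <= theta <= 1 /\ expR (theta ^+ 2 / 8 + (1 - theta) * y) <= 2 - expR (- y).
Proof.
move=> y0; have y1 : 0 < 1 + y by rewrite ltr_wpDr.
have ey : expR (- y) <= (1 + y)^-1.
  by rewrite expRN lef_pV2 ?posrE ?expR_gt0 // expR_ge1Dx.
have main (w : R) : w * (1 + 2 * y) <= y -> expR w <= 2 - expR (- y).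
  move=> wy; have w1 : w < 1 by nra.
  apply: le_trans (expR_le_inv w1) _.
  have -> : (1 - w)^-1 = 1 + w / (1 - w) by field; apply: lt0r_neq0; lra.
  have : w / (1 - w) <= y / (1 + y).
    by rewrite ler_pdivrMr ?subr_gt0 // mulrAC ler_pdivlMr //; lra.
  have -> : y / (1 + y) = 1 - (1 + y)^-1 by field; apply: lt0r_neq0.
  by lra.
(* The choice theta = 4 y minimises theta^2 / 8 - theta y; past y = 1 / 4 it would exceed 1 and is
   replaced by 1. *)
have [le|gt] := lerP y (1 / 4).
  by exists (4 * y); split; [apply/andP; split; lra | apply: main; nra].
by exists 1; split; [rewrite ler01 lexx | apply: main; rewrite expr1n subrr mul0r addr0; nra].
Qed.

Lemma expR_convex (p q theta : R) : 0 <= theta <= 1 ->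
  expR ((1 - theta) * p + theta * q) <= (1 - theta) * expR p + theta * expR q.
Proof.
move=> /andP[t0 t1]; set m := _ + _.
have tangent x : expR m * (1 + (x - m)) <= expR x.
  have -> : expR x = expR m * expR (x - m) by rewrite -expRD subrKC.
  by rewrite ler_pM2l ?expR_gt0 // expR_ge1Dx.
have h1 := ler_wpM2l (_ : 0 <= 1 - theta) (tangent p).
have h2 := ler_wpM2l t0 (tangent q).
apply: le_trans (lerD (h1 _) h2); last by rewrite subr_ge0.
have -> : (1 - theta) * (expR m * (1 + (p - m))) + theta * (expR m * (1 + (q - m))) =
  expR m * (1 + ((1 - theta) * p + theta * q) - m) by ring.
by rewrite -/m addrK mulr1.
Qed.

Variable T : finType.

Section Cons.
Variable n : nat.

Definition ffcons (x : T) (f : {ffun 'I_n -> T}) : {ffun 'I_n.+1 -> T} :=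
  [ffun i => if unlift ord0 i is Some j then f j else x].

Lemma ffcons0 x f : ffcons x f ord0 = x.
Proof. by rewrite ffunE unlift_none. Qed.

Lemma ffconsS x f j : ffcons x f (lift ord0 j) = f j.
Proof. by rewrite ffunE liftK. Qed.

Lemma sum_ffcons (F : {ffun 'I_n.+1 -> T} -> R) :
  \sum_f F f = \sum_x \sum_f F (ffcons x f).
Proof.
rewrite pair_big /=; pose h (p : T * {ffun 'I_n -> T}) := ffcons p.1 p.2.
rewrite (reindex h) //;
exists (fun g : {ffun 'I_n.+1 -> T} => (g ord0, [ffun j : 'I_n => g (lift ord0 j)])).
  move=> [x f] _; rewrite /h /= ffcons0; congr pair.
  by apply/ffunP => j; rewrite ffunE ffconsS.
move=> g _; apply/ffunP => i; rewrite /h ffunE.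
by case: unliftP => [j ->|->] /=; rewrite ?ffunE.
Qed.

End Cons.

Lemma card_sumR (I : finType) (A : pred I) : #|A|%:R = \sum_i (A i)%:R :> R.
Proof.
by rewrite -sum1_card natr_sum big_mkcond /=; apply: eq_bigr => i _; rewrite unfold_in; case: (A i).
Qed.

Lemma cauchy2 (a n p t : R) : (n * p + a * t) ^+ 2 <= (n ^+ 2 + a ^+ 2) * (p ^+ 2 + t ^+ 2).
Proof. by have := sqr_ge0 (n * t - a * p); nra. Qed.

(** M f is a lower bound for Talagrand's convex distance from f to A, witnessed by the nonnegative
    weights alpha f of norm at most 1. *)
Definition certifies n (A : pred {ffun 'I_n -> T}) (M : {ffun 'I_n -> T} -> R)
    (alpha : {ffun 'I_n -> T} -> 'I_n -> R) :=
  [/\ forall f, 0 <= M f, forall f i, 0 <= alpha f i,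
      forall f, \sum_i alpha f i ^+ 2 <= 1 &
      forall f g, A g -> M f <= \sum_i alpha f i * (f i != g i)%:R].

Section Step.

Variables (n : nat) (A : pred {ffun 'I_n.+1 -> T}).
Variables (M : {ffun 'I_n.+1 -> T} -> R) (alpha : {ffun 'I_n.+1 -> T} -> 'I_n.+1 -> R).
Hypothesis cert : certifies A M alpha.
Variable x : T.

(** The two sets of Talagrand's induction on the dimension: the projection of A along the first
    coordinate, and its slice at x. *)
Let B : pred {ffun 'I_n -> T} := fun f => [exists u, A (ffcons u f)].
Let Ax : pred {ffun 'I_n -> T} := fun f => A (ffcons x f).
Let a0 f := alpha (ffcons x f) ord0.
Let nrm f := Num.sqrt (1 - a0 f ^+ 2).
(* If [nrm f = 0] then all the quotients by [nrm f] below are [0]; the estimates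
   remain true. *)
Let beta f j := alpha (ffcons x f) (lift ord0 j) / nrm f.
Let M1 f := M (ffcons x f) / nrm f.
Let M2 f := Num.max 0 (M (ffcons x f) - a0 f) / nrm f.

Let sum_alpha f : a0 f ^+ 2 + \sum_j alpha (ffcons x f) (lift ord0 j) ^+ 2 <= 1.
Proof. by case: cert => _ _ /(_ (ffcons x f)); rewrite big_ord_recl. Qed.

Let sum_ge0 f : 0 <= \sum_j alpha (ffcons x f) (lift ord0 j) ^+ 2.
Proof. by apply: sumr_ge0 => j _; apply: sqr_ge0. Qed.

Let nrm2 f : nrm f ^+ 2 = 1 - a0 f ^+ 2.
Proof. by rewrite sqr_sqrtr //; have := sum_alpha f; have := sum_ge0 f; lra. Qed.

Let beta_sum f : \sum_j beta f j ^+ 2 <= 1.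
Proof.
under eq_bigr do rewrite exprMn; rewrite -mulr_suml exprVn nrm2.
have := sum_alpha f; rewrite -lerBrDl => le.
have [->|ne] := eqVneq (1 - a0 f ^+ 2) 0; first by rewrite invr0 mulr0 ler01.
have gt : 0 < 1 - a0 f ^+ 2 by rewrite lt_def ne (le_trans (sum_ge0 f)).
by rewrite ler_pdivrMr // mul1r.
Qed.

Let beta_ge0 f j : 0 <= beta f j.
Proof. by case: cert => _ a_ge0 _ _; rewrite divr_ge0 // sqrtr_ge0. Qed.

Let dist_cons f u g : \sum_i alpha (ffcons x f) i * (ffcons x f i != ffcons u g i)%:R =
  a0 f * (x != u)%:R + \sum_j alpha (ffcons x f) (lift ord0 j) * (f j != g j)%:R.
Proof.
rewrite big_ord_recl !ffcons0; congr (_ + _).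
by apply: eq_bigr => j _; rewrite !ffconsS.
Qed.

Let sum_beta f g : \sum_j beta f j * (f j != g j)%:R =
  (\sum_j alpha (ffcons x f) (lift ord0 j) * (f j != g j)%:R) / nrm f.
Proof. by rewrite mulr_suml; apply: eq_bigr => j _; rewrite mulrAC. Qed.

Lemma certifies_slice : certifies Ax M1 beta.
Proof.
case: cert => M0 _ _ MA; split=> // [f|f g Ag]; first by rewrite divr_ge0 // sqrtr_ge0.
rewrite sum_beta ler_wpM2r ?invr_ge0 ?sqrtr_ge0 //.
by have := MA (ffcons x f) _ Ag; rewrite dist_cons eqxx mulr0 add0r.
Qed.

Lemma certifies_projection : certifies B M2 beta.
Proof.
case: cert => M0 a_ge0 _ MA; split=> // [f|f g /existsP[u Ag]].
  by rewrite divr_ge0 ?sqrtr_ge0 // le_max lexx.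
rewrite sum_beta ler_wpM2r ?invr_ge0 ?sqrtr_ge0 // ge_max; apply/andP; split.
  by apply: sumr_ge0 => j _; rewrite mulr_ge0.
have := MA (ffcons x f) _ Ag; rewrite dist_cons lerBlDl => /le_trans; apply.
by rewrite lerD2r ler_piMr ?a_ge0 // lern1; case: (x != u).
Qed.

(** A convex combination of M <= nrm M1 and M <= nrm M2 + a0 gives M <= nrm p + a0 theta. As nrm^2 +
    a0^2 = 1, Cauchy-Schwarz bounds M^2 by p^2 + theta^2, and convexity of the square bounds p^2. *)
Lemma certificate_convex f (theta : R) : 0 <= theta <= 1 ->
  (exists g, Ax g) \/ theta = 1 /\ (exists g, B g) ->
  M (ffcons x f) ^+ 2 <= theta ^+ 2 + ((1 - theta) * M1 f ^+ 2 + theta * M2 f ^+ 2).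
Proof.
move=> /andP[t0 t1] ex; case: (cert) => M0 a_ge0 _ MA.
have a0_ge0 : 0 <= a0 f by apply: a_ge0.
have M_ge0 := M0 (ffcons x f).
(* Here all the weight lies on the first coordinate. A point of the slice forces M = 0, and a point
   of the projection forces M <= 1. *)
have [n0|n0] := eqVneq (nrm f) 0.
  have a01 : a0 f = 1.
    by have := nrm2 f; rewrite n0 => ?; apply/eqP; rewrite -(@eqrXn2 _ 2) // expr1n; apply/eqP; lra.
  have alpha0 j : alpha (ffcons x f) (lift ord0 j) = 0.
    have /psumr_eq0P : \sum_j alpha (ffcons x f) (lift ord0 j) ^+ 2 = 0.
      by apply/eqP; rewrite eq_le sum_ge0 andbT; have := sum_alpha f; rewrite a01; lra.
    move=> /(_ (fun j _ => sqr_ge0 _) j isT)/eqP; by rewrite sqrf_eq0 => /eqP.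
  have dist0 u g : A (ffcons u g) -> M (ffcons x f) <= (x != u)%:R.
    move=> /MA => /(_ (ffcons x f)); rewrite dist_cons a01 mul1r.
    by rewrite big1 ?addr0 // => j _; rewrite alpha0 mul0r.
  rewrite /M1 /M2 n0 invr0 !mulr0 !expr0n /= !mulr0 !addr0.
  case: ex => [[g /dist0]|[-> [g /existsP[u /dist0]]]].
    rewrite eqxx => Mle; have -> : M (ffcons x f) = 0.
      by apply/eqP; rewrite eq_le M_ge0 andbT.
    by rewrite expr0n sqr_ge0.
  move=> Mle; rewrite expr1n expr_le1 //; apply: le_trans Mle _.
  by rewrite lern1; case: (x != u).
have M1E : M (ffcons x f) = nrm f * M1 f by rewrite mulrC divfK.
have M2E : M (ffcons x f) <= nrm f * M2 f + a0 f.
  by rewrite [_ * M2 f]mulrC divfK // -lerBlDr le_max lexx orbT.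
set p := (1 - theta) * M1 f + theta * M2 f.
have le : M (ffcons x f) <= nrm f * p + a0 f * theta.
  have : theta * M (ffcons x f) <= theta * (nrm f * M2 f + a0 f) by rewrite ler_wpM2l.
  rewrite /p; have : (1 - theta) * M (ffcons x f) = (1 - theta) * (nrm f * M1 f) by rewrite -M1E.
  by lra.
have sq : M (ffcons x f) ^+ 2 <= (nrm f * p + a0 f * theta) ^+ 2.
  by rewrite lerXn2r // nnegrE (le_trans _ le).
apply: le_trans sq _; apply: le_trans (cauchy2 _ _ _ _) _.
rewrite nrm2 subrK mul1r addrC lerD2l /p.
have := sqr_ge0 (M1 f - M2 f); have : 0 <= theta * (1 - theta) by rewrite mulr_ge0 // subr_ge0.
by nra.
Qed.


Hypothesis IH : forall A' M' alpha', @certifies n A' M' alpha' ->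
  #|A'|%:R * \sum_f expR (M' f ^+ 2 / 8) <= (#|T| ^ n)%:R ^+ 2 :> R.

Lemma slice_bound : (0 < #|B|)%N ->
  #|B|%:R * \sum_f expR (M (ffcons x f) ^+ 2 / 8) <=
    (#|T| ^ n)%:R ^+ 2 * (2 - #|Ax|%:R / #|B|%:R).
Proof.
move=> Bpos; have /card_gt0P[gB BgB] := Bpos.
have IHB := IH certifies_projection; have IHA := IH certifies_slice.
set b : R := #|B|%:R in IHB *; set N : R := (#|T| ^ n)%:R in IHA IHB *.
have b0 : 0 < b by rewrite ltr0n.
have [a_eq0|a_pos] := posnP #|Ax|.
  rewrite a_eq0 mul0r subr0.
  have le f : expR (M (ffcons x f) ^+ 2 / 8) <= expR (1 / 8) * expR (M2 f ^+ 2 / 8).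
    rewrite -expRD ler_expR -mulrDl ler_pM2r ?invr_gt0 //.
    have := @certificate_convex f 1; rewrite ler01 lexx subrr mul0r add0r mul1r expr1n.
    by apply=> //; right; split=> //; exists gB.
  apply: (@le_trans _ _ (expR (1 / 8) * (b * \sum_f expR (M2 f ^+ 2 / 8)))).
    rewrite mulrCA ler_pM2l // mulr_sumr; apply: ler_sum => f _; exact: le.
  have e2 : expR (1 / 8) <= 2 :> R.
    apply: le_trans (expR_le_inv _) _; first by lra.
    by rewrite (_ : (1 - 1 / 8)^-1 = 8 / 7); [lra | field].
  rewrite mulrC ler_pM ?expR_ge0 //.
  by rewrite mulr_ge0 ?(ltW b0) // sumr_ge0 // => f _; apply: expR_ge0.
have /card_gt0P[gA AgA] := a_pos.
set a : R := #|Ax|%:R in IHA *; have a0' : 0 < a by rewrite ltr0n.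
have ab : a <= b.
  rewrite ler_nat; apply/subset_leq_card/subsetP => f; rewrite !unfold_in => Af.
  by apply/existsP; exists x.
have lnab : ln a <= ln b by rewrite ler_ln ?posrE.
have [|theta [th le2]] := @talagrand_exponent (ln b - ln a); first by rewrite subr_ge0.
have EN : expR (- (ln b - ln a)) = a / b.
  by rewrite opprB expRD expRN !lnK ?posrE.
rewrite {}EN in le2.
(* K is a^(1 - theta) b^theta. Carrying ln a and ln b in the exponents lets pointwise convexity of
   exp take the place of Hölder's inequality. *)
set K := expR ((1 - theta) * ln a + theta * ln b).
have bK : b = K * expR ((1 - theta) * (ln b - ln a)).
  rewrite -expRD -[LHS]lnK ?posrE //; congr expR; ring.
have pointwise f : K * expR (M (ffcons x f) ^+ 2 / 8) <=
    expR (theta ^+ 2 / 8) * ((1 - theta) * (a * expR (M1 f ^+ 2 / 8)) +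
                             theta * (b * expR (M2 f ^+ 2 / 8))).
  have := @certificate_convex f theta th (or_introl (ex_intro _ gA AgA)) => Mle.
  apply: (@le_trans _ _ (expR (theta ^+ 2 / 8) *
     expR ((1 - theta) * (ln a + M1 f ^+ 2 / 8) + theta * (ln b + M2 f ^+ 2 / 8)))).
    rewrite -!expRD ler_expR; lra.
  rewrite ler_pM2l ?expR_gt0 //; apply: le_trans (expR_convex _ _ th) _.
  by rewrite !expRD !lnK ?posrE.
have total : K * \sum_f expR (M (ffcons x f) ^+ 2 / 8) <= expR (theta ^+ 2 / 8) * N ^+ 2.
  rewrite mulr_sumr; apply: le_trans (ler_sum _ (fun f _ => pointwise f)) _.
  rewrite -mulr_sumr ler_pM2l ?expR_gt0 // big_split /= -!mulr_sumr.
  case/andP: th => t0 t1.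
  have : (1 - theta) * (a * \sum_f expR (M1 f ^+ 2 / 8)) <= (1 - theta) * N ^+ 2.
    by rewrite ler_wpM2l // subr_ge0.
  have : theta * (b * \sum_f expR (M2 f ^+ 2 / 8)) <= theta * N ^+ 2 by rewrite ler_wpM2l.
  by lra.
rewrite {1}bK mulrAC; apply: le_trans (ler_wpM2r (expR_ge0 _) total) _.
rewrite mulrAC -expRD mulrC ler_wpM2l ?sqr_ge0 //.
Qed.

End Step.

Lemma ffun0_card (F : {ffun 'I_0 -> T} -> R) f0 : \sum_f F f = F f0.
Proof.
have u f : f = f0 by apply/ffunP => -[].
by rewrite (big_pred1 f0) // => f; rewrite /= (u f) eqxx.
Qed.

Lemma talagrand n A M alpha : @certifies n A M alpha ->
  #|A|%:R * \sum_f expR (M f ^+ 2 / 8) <= (#|T| ^ n)%:R ^+ 2 :> R.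
Proof.
elim: n A M alpha => [|n IH] A M alpha cert.
  have f0 : {ffun 'I_0 -> T} by apply: finfun => -[].
  rewrite (ffun0_card _ f0) expn0 expr1n.
  have le1 : (#|A| <= 1)%N by apply: leq_trans (max_card _) _; rewrite card_ffun card_ord expn0.
  have [->|] := posnP #|A|; first by rewrite mul0r ler01.
  case/card_gt0P => g Ag; case: cert => M0 _ _ /(_ f0 g Ag); rewrite big_ord0 => Mle.
  have -> : M f0 = 0 by apply/eqP; rewrite eq_le Mle M0.
  by rewrite expr0n mul0r expR0 mulr1 lern1.
pose B : pred {ffun 'I_n -> T} := fun f => [exists u, A (ffcons u f)].
pose Ax u : pred {ffun 'I_n -> T} := fun f => A (ffcons u f).
have cardA : #|A|%:R = \sum_u #|Ax u|%:R :> R.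
  rewrite card_sumR sum_ffcons; apply: eq_bigr => u _; by rewrite card_sumR.
have slice u := @slice_bound n A M alpha cert u IH.
rewrite -/B in slice; have [B0|Bpos] := posnP #|B|.
  rewrite cardA big1 ?mul0r ?sqr_ge0 // => u _.
  rewrite (_ : #|Ax u| = 0%N) //; apply: eq_card0 => f; apply/negP => Af.
  have /negP[] := negbT (card0_eq B0 f).
  by rewrite unfold_in; apply/existsP; exists u.
rewrite sum_ffcons.
set S := (\sum_u \sum_f _); set N : R := (#|T| ^ n)%:R.
have b0 : 0 < #|B|%:R :> R by rewrite ltr0n.
have le : #|B|%:R * S <= N ^+ 2 * (2 * #|T|%:R - #|A|%:R / #|B|%:R).
  rewrite mulr_sumr; apply: le_trans (ler_sum _ (fun u _ => slice u Bpos)) _.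
  rewrite -mulr_sumr ler_wpM2l ?sqr_ge0 // sumrB sumr_const -mulr_suml -cardA.
  by rewrite -[X in _ *+ X]/#|T| mulr_natr.
rewrite expnS natrM exprMn -/N.
set y := #|A|%:R / #|B|%:R in le; have y0 : 0 <= y by rewrite divr_ge0.
have -> : #|A|%:R = y * #|B|%:R :> R by rewrite divfK // lt0r_neq0.
rewrite -mulrA; apply: le_trans (ler_wpM2l y0 le) _.
rewrite mulrCA mulrC ler_wpM2r ?sqr_ge0 //.
(* The slices sum up to y (2 |T| - y), which is at most |T|^2. *)
have := sqr_ge0 (#|T|%:R - y); nra.
Qed.

End Talagrand.

(** * The expected coverage of a uniform tree *)

Section UniformTrees.

Variable t : nat.
Hypothesis t_gt0 : 0 < t.
Implicit Types (f g : {ffun 'I_t -> 'I_t}) (G : {set {set 'I_t}}).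

Lemma treesP G : G \in trees t <-> is_tree G.
Proof. by rewrite inE; split=> /asboolP. Qed.

Lemma cov_le_card l G : cov l G <= t.
Proof.
have [ss [ps -> _]] := cov_witness G l; move: ps; rewrite path_systemE => /andP[_ us].
by rewrite -covered_card // -[X in _ <= X]card_ord max_card.
Qed.

Lemma sum_parent_fns_trees (phi : {set {set 'I_t}} -> nat) :
  \sum_(f in parent_fns 'I_t) phi (fedges f) = t * \sum_(G in trees t) phi G.
Proof. by rewrite (sum_parent_fns _ treesP) card_ord. Qed.

Lemma sum_trees_spines (phi : {set {set 'I_t}} -> nat) :
  \sum_(g in parent_fns 'I_t) \sum_(v : 'I_t) phi (fedges g) =
  t ^ 2 * \sum_(G in trees t) phi G.
Proof.
under eq_bigr do rewrite sum_nat_const card_ord.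
by rewrite -big_distrr /= sum_parent_fns_trees mulnA.
Qed.

(** Joyal's correspondence applied to the constant 1: bipointed trees are as many as functions. *)
Lemma cayley : t ^ 2 * #|trees t| = t ^ t.
Proof.
have V0 : 0 < #|'I_t| by rewrite card_ord.
rewrite -sum1_card -sum_trees_spines (sum_unspine_tie (fun=> 1) V0).
by rewrite sum1_card card_ffun card_ord.
Qed.

Lemma card_trees_gt0 : 0 < #|trees t|.
Proof.
have : 0 < t ^ 2 * #|trees t| by rewrite cayley expn_gt0 t_gt0.
by rewrite muln_gt0 => /andP[].
Qed.

Lemma fedges_unspine g v : fedges (unspine g v) \subset fedges g.
Proof.
apply/subsetP => e /imsetP[x]; rewrite inE ffunE.
case: ifP => _; first by rewrite eqxx.
by move=> gx ->; apply/imsetP; exists x.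
Qed.

Lemma sum_cov_lower l : 8 * l.+1 ^ 2 <= t ->
  t * #|trees t| <= 4 * l.+1 * \sum_(G in trees t) cov l G.
Proof.
move=> lt; have V0 : 0 < #|'I_t| by rewrite card_ord.
rewrite -(@leq_pmul2l (t ^ 2)) ?expn_gt0 ?t_gt0 //.
have E : t ^ 2 * (t * #|trees t|) = t * t ^ t by rewrite -cayley; lia.
have := @sum_deep_lower 'I_t l; rewrite card_ord => /(_ lt) low.
rewrite {}E; apply: leq_trans low _.
rewrite mulnCA leq_mul2l -sum_trees_spines; apply/orP; right.
under [X in X <= _]eq_bigr do rewrite -deep_tie.
rewrite -(sum_unspine_tie (fun h => #|deep l h|) V0).
apply: leq_sum => g; rewrite inE => /existsP[r pg]; apply: leq_sum => v _.
exact: deep_le_cov (unspine_forest v pg) (fedges_unspine g v).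
Qed.

Lemma sum_cov_upper_nat k l : 0 < k -> 8 * k <= l.+1 -> l.+1 < 8 * k.+1 ->
  2 * k * (t ^ 2 * \sum_(G in trees t) cov l G) <=
  64 * k * \sum_(f : {ffun 'I_t -> 'I_t}) #|deep k f| + 64 * t * t ^ t.
Proof.
move=> k0 kl lk; have V0 : 0 < #|'I_t| by rewrite card_ord.
pose phi (h : {ffun 'I_t -> 'I_t}) := 64 * k * #|deep k h| + 32 * #|fixpts h| ^ 2.
apply: (@leq_trans (\sum_f phi (tie f))).
  rewrite -(sum_unspine_tie phi V0) -sum_trees_spines big_distrr /=.
  apply: leq_sum => g; rewrite inE => /existsP[r pg].
  rewrite big_distrr /=; apply: leq_sum => v _.
  exact: cov_le_unspine pg k0 kl lk.
rewrite big_split /= -!big_distrr /=; under eq_bigr do rewrite deep_tie.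
rewrite leq_add2l; have := sum_sqr_cyc 'I_t; rewrite card_ord => le.
by apply: leq_trans (leq_mul (leqnn 32) le) _; rewrite !mulnA.
Qed.

Local Open Scope ring_scope.

Variable R : realType.

Lemma natr_tree_gt0 : 0 < #|trees t|%:R :> R.
Proof. by rewrite ltr0n card_trees_gt0. Qed.

Lemma expect_cov_sum l : expect_cov R t l = (\sum_(G in trees t) cov l G)%:R / #|trees t|%:R.
Proof. by rewrite /expect_cov /unif_expect natr_sum. Qed.

Lemma expect_cov_le l : expect_cov R t l <= t%:R.
Proof.
rewrite expect_cov_sum ler_pdivrMr ?natr_tree_gt0 // -natrM ler_nat mulnC.
by rewrite -sum_nat_const; apply: leq_sum => G _; apply: cov_le_card.
Qed.

Lemma expect_cov_lower l : (1 <= l)%N -> (64 * l ^ 2 <= t)%N ->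
  1 / 8 * t%:R / l%:R <= expect_cov R t l.
Proof.
move=> l1 lt; have l0 : 0 < l%:R :> R by rewrite ltr0n.
have /sum_cov_lower : (8 * l.+1 ^ 2 <= t)%N by nia.
rewrite expect_cov_sum ler_pdivlMr ?natr_tree_gt0 // mulrAC ler_pdivrMr //.
set S := (\sum_(G in _) _)%N => low.
have : (t * #|trees t| <= 8 * (S * l))%N by nia.
by rewrite -(ler_nat R) !natrM; lra.
Qed.

Lemma expect_cov_upper l : (1 <= l)%N -> expect_cov R t l <= 2400 * t%:R / l%:R.
Proof.
move=> l1; have l0 : 0 < l%:R :> R by rewrite ltr0n.
have t0 : 0 < t%:R :> R by rewrite ltr0n.
(* If k = 0 then l <= 6 and cov <= t is enough. Otherwise 2 k t^2 S <= (64 * 4 + 64) t t^t yields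
   the constant 160, and l <= 15 k yields 2400 = 15 * 160. *)
pose k := (l.+1 %/ 8)%N.
have kl : (8 * k <= l.+1)%N by rewrite mulnC leq_trunc_div.
have lk : (l.+1 < 8 * k.+1)%N by rewrite mulnC ltn_ceil.
have [k0|k0] := posnP k.
  apply: le_trans (expect_cov_le l) _; rewrite ler_pdivlMr // mulrC ler_pM2r //.
  by rewrite ler_nat; rewrite k0 in lk; lia.
have K0 : 0 < k%:R :> R by rewrite ltr0n.
have := sum_cov_upper_nat k0 kl lk; rewrite -(ler_nat R).
set S := (\sum_(G in _) _)%N; set D := (\sum_f _)%N => up.
have := @sum_deep_upper R 'I_t (Ordinal t_gt0) k; rewrite card_ord -/D => upD.
have {}upD : k%:R * D%:R <= 4 * (t%:R * t%:R ^+ t) :> R.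
  have := ler_wpM2l (ltW K0) upD => /le_trans; apply.
  have -> : k%:R * (t%:R * t%:R ^+ t * (4 / (k + 4)%:R)) =
    4 * (t%:R * t%:R ^+ t) * (k%:R / (k + 4)%:R) :> R by rewrite natrD; field; apply: lt0r_neq0; lra.
  rewrite ler_piMr ?mulr_ge0 ?exprn_ge0 // ler_pdivrMr ?ltr0n ?addn_gt0 ?orbT //.
  by rewrite mul1r ler_nat leq_addr.
have Tt : t%:R ^+ 2 * #|trees t|%:R = t%:R ^+ t :> R by rewrite -!natrX -natrM cayley.
have {}up : k%:R * S%:R <= 160 * t%:R * #|trees t|%:R :> R.
  rewrite -(@ler_pM2l _ (2 * t%:R ^+ 2)) ?mulr_gt0 ?exprn_gt0 //.
  move: up; rewrite !natrD !natrM !natrX -Tt in upD *.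
  by lra.
rewrite expect_cov_sum ler_pdivrMr ?natr_tree_gt0 // mulrAC ler_pdivlMr // -/S.
have lk15 : l%:R <= 15 * k%:R :> R by rewrite -natrM ler_nat; lia.
apply: (@le_trans _ _ (S%:R * (15 * k%:R))); first by rewrite ler_wpM2l.
by lra.
Qed.

End UniformTrees.

Local Open Scope ring_scope.

(** * Concentration *)

Section Concentration.

Variables (R : realType) (t : nat).
Hypothesis t_gt0 : (0 < t)%N.
Implicit Types (f g : {ffun 'I_t -> 'I_t}) (G : {set {set 'I_t}}).

(** Talagrand's exponent M^2 / 8 for the Lipschitz constant m = 2 l + 1 and certificates of at most
    b + m vertices. *)
Definition gap l (a b : R) : R := (b - a) ^+ 2 / (8 * (l.*2.+1)%:R ^+ 2 * (b + (l.*2.+1)%:R)).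

Lemma fedges_cov_tails l (a b : R) : 0 <= a -> a < b ->
  #|[pred f : {ffun 'I_t -> 'I_t} | (cov l (fedges f))%:R <= a]|%:R *
  #|[pred f : {ffun 'I_t -> 'I_t} | b < (cov l (fedges f))%:R]|%:R * expR (gap l a b) <= (t ^ t)%:R ^+ 2.
Proof.
move=> a0 ab; have b0 : 0 <= b by rewrite ltW // (le_lt_trans a0).
set m : R := (l.*2.+1)%:R; have m0 : 0 < m by rewrite ltr0n.
pose bn := Num.truncn b.
have bnP c : (b < c%:R) = (bn < c)%N.
  by rewrite /bn truncn_lt_nat.
have wit (f : {ffun 'I_t -> 'I_t}) : exists W : {set 'I_t}, (bn < cov l (fedges f))%N ->
    (bn < #|W| <= bn + l.*2.+1)%N /\
    forall f' : {ffun 'I_t -> 'I_t}, (#|W| <= cov l (fedges f') + l.*2.+1 * #|[set x in W | f x != f' x]|)%N.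
  have [lt|_] := ltnP bn (cov l (fedges f)); last by exists set0.
  by have [W HW] := cov_certificate lt; exists W.
have [W WP] := choice wit.
pose s : R := Num.sqrt (b + m); have bm0 : 0 < b + m by rewrite ltr_wpDl.
have s0 : 0 < s by rewrite sqrtr_gt0.
pose M0 := (b - a) / (m * s).
have M00 : 0 <= M0 by rewrite divr_ge0 ?subr_ge0 ?mulr_ge0 // ltW.
pose up (f : {ffun 'I_t -> 'I_t}) := b < (cov l (fedges f))%:R.
pose M f := if up f then M0 else 0.
(* Equal weights on the certificate, normalised by |W f| <= s^2. If cov is at most a at g, then f
   and g differ in at least (b - a) / m points of W f. *)
pose alpha (f : {ffun 'I_t -> 'I_t}) (i : 'I_t) : R := if up f then (i \in W f)%:R / s else 0.
have cert : certifies [pred f : {ffun 'I_t -> 'I_t} | (cov l (fedges f))%:R <= a] M alpha.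
  split.
  - by move=> f; rewrite /M; case: ifP.
  - by move=> f i; rewrite /alpha; case: ifP => // _; rewrite divr_ge0 // ltW.
  - move=> f; rewrite /alpha; case: (boolP (up f)) => [upf|_]; last first.
      by rewrite big1 ?ler01 // => i _; rewrite expr0n.
    have /WP[/andP[_ leW] _] : (bn < cov l (fedges f))%N by rewrite -bnP.
    under eq_bigr do rewrite expr_div_n.
    rewrite sqr_sqrtr ?(ltW bm0) //.
    rewrite -mulr_suml ler_pdivrMr // mul1r.
    have -> : \sum_(i < t) ((i \in W f)%:R : R) ^+ 2 = #|W f|%:R.
      rewrite -sum1_card natr_sum [RHS]big_mkcond /=; apply: eq_bigr => i _.
      by case: (i \in W f); rewrite ?expr1n ?expr0n.
    apply: (@le_trans _ _ (bn%:R + m)); first by rewrite -natrD ler_nat.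
    by rewrite lerD2r /bn truncn_le.
  - move=> f g /= ga; rewrite /M /alpha; case: (boolP (up f)) => [upf|_]; last first.
      by rewrite big1 // => i _; rewrite mul0r.
    have /WP[/andP[ltW _] lipW] : (bn < cov l (fedges f))%N by rewrite -bnP.
    have -> : \sum_i (i \in W f)%:R / s * (f i != g i)%:R =
        #|[set x in W f | f x != g x]|%:R / s :> R.
      rewrite -sum1_card natr_sum [in RHS]big_mkcond mulr_suml /=; apply: eq_bigr => i _.
      by rewrite inE; case: (i \in W f); case: (f i != g i); rewrite ?mul0r ?mulr1 ?mulr0.
    rewrite /M0 invfM mulrA ler_pM2r ?invr_gt0 // ler_pdivrMr //.
    have := lipW g; rewrite -(ler_nat R) natrD natrM -/m.
    have : b < #|W f|%:R by rewrite bnP.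
    by lra.
have := talagrand cert; rewrite card_ord => le; apply: le_trans le.
rewrite -mulrA ler_wpM2l // card_sumR mulr_suml; apply: ler_sum => f _.
rewrite /M /up /=; case: ifP => _; last by rewrite mul0r expR_ge0.
rewrite mul1r ler_expR /gap /M0 expr_div_n exprMn sqr_sqrtr ?(ltW bm0) // -/m.
have -> : (b - a) ^+ 2 / (m ^+ 2 * (b + m)) / 8 = (b - a) ^+ 2 / (8 * m ^+ 2 * (b + m)).
  by rewrite -mulrA -invfM; congr (_ / _); ring.
exact: lexx.
Qed.

Local Notation Pr E := (unif_prob R (trees t) E).

Lemma unif_prob_fedges (Q : pred {set {set 'I_t}}) :
  Pr Q <= t%:R * (#|[pred f : {ffun 'I_t -> 'I_t} | Q (fedges f)]|%:R / (t ^ t)%:R).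
Proof.
have T0 := natr_tree_gt0 t_gt0 R; have t0 : 0 < t%:R :> R by rewrite ltr0n.
rewrite /unif_prob ler_pdivrMr // -(cayley t_gt0) natrM natrX.
have : (t * #|[set G in trees t | Q G]| <= #|[pred f : {ffun 'I_t -> 'I_t} | Q (fedges f)]|)%N.
  have -> : #|[set G in trees t | Q G]| = (\sum_(G in trees t) Q G)%N.
    rewrite -sum1_card big_mkcond [RHS]big_mkcond /=; apply: eq_bigr => G _.
    by rewrite inE; case: (G \in trees t); case: (Q G).
  rewrite -(sum_parent_fns_trees (fun G => Q G : nat)) -sum1_card.
  rewrite big_mkcond [X in (_ <= X)%N]big_mkcond /=; apply: leq_sum => f _.
  by case: (f \in parent_fns _) => //; rewrite unfold_in /=; case: (Q _).
rewrite -(ler_nat R) natrM => le.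
have -> : t%:R * (#|[pred f : {ffun 'I_t -> 'I_t} | Q (fedges f)]|%:R / (t%:R ^+ 2 * #|trees t|%:R)) * #|trees t|%:R
   = #|[pred f : {ffun 'I_t -> 'I_t} | Q (fedges f)]|%:R / t%:R :> R by field; rewrite !lt0r_neq0.
by rewrite ler_pdivlMr // mulrC.
Qed.

Lemma unif_prob_ge0 (Q : pred {set {set 'I_t}}) : 0 <= Pr Q.
Proof. by rewrite divr_ge0. Qed.

Lemma unif_prob_le1 (Q : pred {set {set 'I_t}}) : Pr Q <= 1.
Proof.
rewrite ler_pdivrMr ?(natr_tree_gt0 t_gt0) // mul1r ler_nat.
by apply/subset_leq_card/subsetP => G; rewrite inE => /andP[].
Qed.

Lemma unif_prob_expect (Q : pred {set {set 'I_t}}) :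
  Pr Q = unif_expect (trees t) (fun G => (Q G)%:R).
Proof.
rewrite /unif_prob /unif_expect; congr (_ / _).
rewrite -sum1_card natr_sum big_mkcond [RHS]big_mkcond /=; apply: eq_bigr => G _.
by rewrite inE; case: (G \in trees t); case: (Q G).
Qed.

Lemma tree_cov_tails l (a b : R) : 0 <= a -> a < b ->
  Pr (fun G => (cov l G)%:R <= a) * Pr (fun G => b < (cov l G)%:R) <=
  t%:R ^+ 2 * expR (- gap l a b).
Proof.
move=> a0 ab; have N0 : 0 < (t ^ t)%:R :> R by rewrite ltr0n expn_gt0 t_gt0.
have := fedges_cov_tails l a0 ab.
have := unif_prob_fedges (fun G => (cov l G)%:R <= a).
have := unif_prob_fedges (fun G => b < (cov l G)%:R).
set pb := unif_prob _ _ _; set pa := unif_prob _ _ _.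
set cb : R := #|_|%:R; set ca : R := #|_|%:R => lb la main.
apply: le_trans (ler_pM (unif_prob_ge0 _) (unif_prob_ge0 _) la lb) _.
rewrite mulrACA -expr2 ler_wpM2l ?sqr_ge0 // expRN.
rewrite -[(expR _)^-1]mul1r ler_pdivlMr ?expR_gt0 //.
have -> : ca / (t ^ t)%:R * (cb / (t ^ t)%:R) * expR (gap l a b) =
  ca * cb * expR (gap l a b) / (t ^ t)%:R ^+ 2 by field; rewrite lt0r_neq0.
by rewrite ler_pdivrMr ?mul1r // exprn_gt0.
Qed.

Lemma unif_expectD_le (F H : {set {set 'I_t}} -> R) :
  (forall G, F G <= H G) -> unif_expect (trees t) F <= unif_expect (trees t) H.
Proof.
by move=> FH; rewrite ler_wpM2r ?invr_ge0 // ler_sum.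
Qed.

Lemma unif_expect_affine (F : {set {set 'I_t}} -> R) (u w : R) :
  unif_expect (trees t) (fun G => u + w * F G) = u + w * unif_expect (trees t) F.
Proof.
have T0 := natr_tree_gt0 t_gt0 R.
rewrite /unif_expect big_split /= -mulr_sumr sumr_const -(mulr_natr u) mulrDl -mulrA.
by rewrite divff ?mulr1 ?mulrA // lt0r_neq0.
Qed.

(** The expectation of mu + d - cov equals d, while this variable is at most mu + d <= 2 t and is
    positive only on the event. *)
Lemma prob_cov_le_ge l (d : R) : 0 < d <= t%:R ->
  d / (2 * t%:R) <= Pr (fun G => (cov l G)%:R <= expect_cov R t l + d).
Proof.
move=> /andP[d0 dt]; have t0 : 0 < t%:R :> R by rewrite ltr0n.
set mu := expect_cov R t l; have mut : mu <= t%:R := expect_cov_le t_gt0 R l.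
have mu0 : 0 <= mu by rewrite divr_ge0 // sumr_ge0.
rewrite ler_pdivrMr ?mulr_gt0 //.
have : unif_expect (trees t) (fun G => (mu + d) + (-1) * (cov l G)%:R) <=
  unif_expect (trees t) (fun G => 0 + (mu + d) * ((cov l G)%:R <= mu + d)%R%:R).
  apply: unif_expectD_le => G; have X0 : 0 <= (cov l G)%:R :> R by [].
  by case: (lerP (cov l G)%:R (mu + d)) => le; rewrite ?mulr1 ?mulr0; lra.
rewrite !unif_expect_affine -unif_prob_expect -/(expect_cov R t l) -/mu.
have := unif_prob_ge0 (fun G => (cov l G)%:R <= mu + d).
set p := unif_prob _ _ _; nra.
Qed.

Lemma prob_cov_gt_ge l (d : R) : 0 < d -> d <= expect_cov R t l ->
  d / (2 * t%:R) <= Pr (fun G => expect_cov R t l - d < (cov l G)%:R).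
Proof.
move=> d0 dmu; have t0 : 0 < t%:R :> R by rewrite ltr0n.
set mu := expect_cov R t l in dmu *.
rewrite ler_pdivrMr ?mulr_gt0 //.
have : unif_expect (trees t) (fun G => (d - mu) + 1 * (cov l G)%:R) <=
  unif_expect (trees t) (fun G => 0 + t%:R * (mu - d < (cov l G)%:R)%R%:R).
  apply: unif_expectD_le => G.
  have Xt : (cov l G)%:R <= t%:R :> R by rewrite ler_nat cov_le_card.
  by case: (ltrP (mu - d) (cov l G)%:R) => le; rewrite ?mulr1 ?mulr0; lra.
rewrite !unif_expect_affine -unif_prob_expect -/(expect_cov R t l) -/mu.
have := unif_prob_ge0 (fun G => mu - d < (cov l G)%:R).
set p := unif_prob _ _ _; nra.
Qed.

End Concentration.

Lemma double_succ_le l : (0 < l)%N -> (l.*2.+1 <= 3 * l)%N.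
Proof. by lia. Qed.

(** * From the product of two tails to a two-sided tail *)

Section Tail.

Variables (R : realType) (t l : nat) (delta C : R).
Hypotheses (t_gt0 : (0 < t)%N) (l_gt0 : (0 < l)%N) (lt : (l ^ 2 <= t)%N).
Hypotheses (delta01 : 0 < delta < 1) (C_gt0 : 0 < C).
Hypothesis mean_le : expect_cov R t l <= C * (t%:R / l%:R).

Local Notation Pr E := (unif_prob R (trees t) E).
Let mu := expect_cov R t l.
(** Half of the allowed deviation: one half keeps the side near the mean at probability at least d /
    (2 t), the other half is the gap b - a. *)
Let d := delta * t%:R / (2 * l%:R).
(** The constant 288 is 8 * 9 * 4, from [gap], from m <= 3 l squared and from the 2 in d squared; C
    + 4 comes from b <= (C + 1) t / l and m <= 3 l <= 3 t / l. *)
Let rate := delta ^+ 2 * t%:R / l%:R ^+ 3 / (288 * (C + 4)).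

Let K0 : 0 < C + 4. Proof. by rewrite ltr_wpDl // ltW. Qed.
Let t0 : 0 < t%:R :> R. Proof. by rewrite ltr0n. Qed.
Let l0 : 0 < l%:R :> R. Proof. by rewrite ltr0n. Qed.
Let delta0 : 0 < delta. Proof. by case/andP: delta01. Qed.
Let d0 : 0 < d. Proof. by rewrite divr_gt0 ?mulr_gt0. Qed.

Let ltl : l%:R <= t%:R / l%:R :> R.
Proof. by rewrite ler_pdivlMr // -natrM ler_nat mulnn. Qed.

Let two_d : 2 * d = delta * t%:R / l%:R.
Proof. by rewrite /d; field; apply: lt0r_neq0. Qed.

Lemma gap_lower (a b : R) : b - a = d -> 0 <= b -> b <= (C + 1) * (t%:R / l%:R) ->
  rate <= gap l a b.
Proof.
move=> abd b0 ble; rewrite /gap abd.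
set m : R := (l.*2.+1)%:R.
have m0 : 0 < m by rewrite ltr0n.
have m3 : m <= 3 * l%:R.
  by have := double_succ_le l_gt0; rewrite -(ler_nat R) natrM.
have D0 : 0 < 8 * m ^+ 2 * (b + m) by rewrite !mulr_gt0 ?exprn_gt0 ?ltr_wpDl.
rewrite ler_pdivlMr //.
have -> : d ^+ 2 = rate * (8 * (3 * l%:R) ^+ 2 * ((C + 4) * (t%:R / l%:R))).
  by rewrite /rate /d; field; rewrite !lt0r_neq0.
have rate0 : 0 <= rate.
  by rewrite /rate !divr_ge0 ?mulr_ge0 ?sqr_ge0 ?exprn_ge0 ?(ltW K0) // ltW.
rewrite ler_wpM2l // ler_pM ?mulr_ge0 ?sqr_ge0 ?addr_ge0 ?(ltW m0) //.
  by rewrite ler_pM2l // lerXn2r // nnegrE ?(ltW m0) // mulr_ge0 // ltW.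
have -> : (C + 4) * (t%:R / l%:R) = (C + 1) * (t%:R / l%:R) + 3 * (t%:R / l%:R) by ring.
by rewrite lerD //; apply: le_trans m3 _; rewrite ler_wpM2l.
Qed.

Lemma tail_from_product (p q : R) (a b : R) :
  b - a = d -> 0 <= b -> b <= (C + 1) * (t%:R / l%:R) ->
  0 <= q -> d / (2 * t%:R) <= p -> p * q <= t%:R ^+ 2 * expR (- gap l a b) ->
  q <= 4 * l%:R * t%:R ^+ 2 / delta * expR (- rate).
Proof.
move=> abd b0 ble q0 ple le.
have {}le : p * q <= t%:R ^+ 2 * expR (- rate).
  by apply: le_trans le _; rewrite ler_wpM2l ?sqr_ge0 // ler_expR lerN2 gap_lower.
have dp : d / (2 * t%:R) = delta / (4 * l%:R).
  by rewrite /d; field; rewrite !lt0r_neq0.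
rewrite dp in ple; have := le_trans (ler_wpM2r q0 ple) le.
have -> : 4 * l%:R * t%:R ^+ 2 / delta * expR (- rate) =
  t%:R ^+ 2 * expR (- rate) / (delta / (4 * l%:R)) by field; rewrite !lt0r_neq0.
by rewrite ler_pdivlMr ?divr_gt0 ?mulr_gt0 // mulrC.
Qed.

Lemma expect_cov_ge0 : 0 <= mu.
Proof. by rewrite divr_ge0 // sumr_ge0. Qed.

Lemma upper_tail :
  Pr (fun G => mu + 2 * d < (cov l G)%:R) <= 4 * l%:R * t%:R ^+ 2 / delta * expR (- rate).
Proof.
have mu0 := expect_cov_ge0; have dd := d0.
apply: tail_from_product (tree_cov_tails t_gt0 l (a := mu + d) (b := mu + 2 * d) _ _);
  rewrite ?unif_prob_ge0 ?addr_ge0 ?(ltW d0) //; try lra.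
- rewrite two_d mulrDl mul1r lerD // -mulrA ler_piMl ?divr_ge0 //.
  by case/andP: delta01 => _ /ltW.
- apply: prob_cov_le_ge => //; rewrite d0 /= /d ler_pdivrMr ?mulr_gt0 //.
  rewrite mulrC ler_pM2l //; have : 1 <= l%:R :> R by rewrite ler1n.
  by case/andP: delta01 => _; lra.
Qed.

Lemma lower_tail :
  Pr (fun G => (cov l G)%:R <= mu - 2 * d) <= 4 * l%:R * t%:R ^+ 2 / delta * expR (- rate).
Proof.
have mu0 := expect_cov_ge0; have dd := d0.
(* For mu < 2 d the event is empty, as cov is nonnegative; otherwise mu - 2 d is an admissible lower
   threshold. *)
have [dmu|mud] := lerP (2 * d) mu; last first.
  rewrite /unif_prob eq_card0 ?mul0r.
    by rewrite !mulr_ge0 ?expR_ge0 ?sqr_ge0 ?invr_ge0 // ltW.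
  move=> G; rewrite inE; apply/negbTE; rewrite negb_and -ltNge; apply/orP; right.
  by apply: (@lt_le_trans _ _ 0); rewrite ?subr_lt0.
have le : Pr (fun G => mu - d < (cov l G)%:R) * Pr (fun G => (cov l G)%:R <= mu - 2 * d)
    <= t%:R ^+ 2 * expR (- gap l (mu - 2 * d) (mu - d)).
  by rewrite mulrC; apply: tree_cov_tails => //; lra.
apply: (tail_from_product _ _ _ _ _ le); rewrite ?unif_prob_ge0 //; try lra.
- rewrite mulrDl mul1r; apply: (@le_trans _ _ mu); first by rewrite gerBl ltW.
  by apply: le_trans mean_le _; rewrite lerDl divr_ge0.
- by apply: prob_cov_gt_ge => //; rewrite -/mu; lra.
Qed.

Lemma cov_two_sided_tail :
  Pr (fun G => delta * t%:R / l%:R < `|(cov l G)%:R - mu|) <=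
  8 * l%:R * t%:R ^+ 2 / delta * expR (- rate).
Proof.
have := upper_tail; have := lower_tail.
set q1 := unif_prob _ _ _; set q2 := unif_prob _ _ _ => le1 le2.
apply: (@le_trans _ _ (q1 + q2)); last by lra.
rewrite /q1 /q2 /unif_prob -mulrDl ler_wpM2r ?invr_ge0 // -natrD ler_nat.
apply: leq_trans (leq_card_setU _ _); apply/subset_leq_card/subsetP => G.
rewrite !inE => /andP[-> /=]; rewrite -two_d.
have [le|gt] := lerP (cov l G)%:R (mu - 2 * d) => //=.
by rewrite ltr_normr => /orP[]; lra.
Qed.

End Tail.

Theorem theorem1p5 (R : realType) :
  (exists C1 C2 : R, [/\ 0 < C1, 0 < C2 &
    forall t : nat,
      (forall l : nat, (1 <= l <= t)%N ->
         expect_cov R t l <= C1 * t%:R / l%:R)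
      /\
      (forall l : nat, (1 <= l)%N -> l%:R <= C2 * Num.sqrt t%:R ->
         C2 * t%:R / l%:R <= expect_cov R t l)])
  /\
  (exists c : R, 0 < c /\
    forall (t l : nat) (delta : R),
      (1 <= l)%N -> l%:R <= c * Num.sqrt t%:R -> 0 < delta < 1 ->
      unif_prob R (trees t)
        (fun T => delta * t%:R / l%:R < `|(cov l T)%:R - expect_cov R t l|)
      <= c * t%:R ^+ 2 / (delta * expR (c * delta ^+ 2 * t%:R / l%:R ^+ 3))).
Proof.
have sqr_le (c : R) (t l : nat) : 0 <= c -> l%:R <= c * Num.sqrt t%:R ->
    l%:R ^+ 2 <= c ^+ 2 * t%:R.
  by move=> c0 lt; rewrite -[t%:R]sqr_sqrtr // -exprMn lerXn2r ?nnegrE ?mulr_ge0 ?sqrtr_ge0 //.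
have t_pos (t l : nat) (c : R) : (1 <= l)%N -> l%:R <= c * Num.sqrt t%:R -> (0 < t)%N.
  case: t => //; rewrite sqrtr0 mulr0 => l1; rewrite lern0 => /eqP l0.
  by rewrite l0 in l1.
have [C C0 upC] : exists2 C : R, 0 < C & forall t l : nat, (0 < t)%N -> (1 <= l)%N ->
    expect_cov R t l <= C * t%:R / l%:R.
  by exists 2400 => // t l t0 l1; apply: expect_cov_upper.
split.
  exists C, (1 / 8); split=> [//||t]; [lra | split=> l].
    move=> /andP[l1 lt]; apply: upC => //; exact: leq_trans lt.
  move=> l1 lt; have t0 := t_pos _ _ _ l1 lt.
  apply: expect_cov_lower => //; rewrite -(ler_nat R) natrM natrX.
  by have := sqr_le _ _ _ _ lt; lra.
pose K := C + 4; have K4 : 4 <= K by rewrite lerDr ltW.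
(* As 600 >= 2 * 288, the rate 1 / (288 K) is at least 2 c, which leaves room for squaring the
   target bound. *)
pose c := (600 * K)^-1.
have cK : c * K = 1 / 600 by rewrite /c; field; apply: lt0r_neq0; lra.
have c0 : 0 < c by rewrite invr_gt0; lra.
have c1 : c <= 1 / 8 by nra.
have cK' : 2 * c <= (288 * K)^-1.
  by rewrite -[X in _ <= X]mul1r ler_pdivlMr; lra.
exists c; clearbody c.
split=> // t l delta l1 lt delta01; have tn0 := t_pos _ _ _ l1 lt.
have {}lt := sqr_le _ _ _ (ltW c0) lt.
have t0 : 0 < t%:R :> R by rewrite ltr0n.
have l0 : 1 <= l%:R :> R by rewrite ler1n.
have ltn : (l ^ 2 <= t)%N.
  rewrite -(ler_nat R) natrX; apply: le_trans lt _.
  by rewrite ler_piMl // expr_le1 ?ltW //; lra.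
have := cov_two_sided_tail tn0 l1 ltn delta01 C0 _; rewrite mulrA -/K => /(_ (upC _ _ tn0 l1)).
have := unif_prob_le1 R tn0 (fun T => delta * t%:R / l%:R < `|(cov l T)%:R - expect_cov R t l|).
set P := unif_prob _ _ _ => P1 tail; clearbody K; have P0 : 0 <= P := unif_prob_ge0 _ _.
case/andP: delta01 => d0 d1.
set z := delta ^+ 2 * t%:R / l%:R ^+ 3 in tail.
have z0 : 0 <= z by rewrite !mulr_ge0 ?sqr_ge0 ?invr_ge0 ?exprn_ge0 //; lra.
have -> : c * delta ^+ 2 * t%:R / l%:R ^+ 3 = c * z by rewrite /z !mulrA.
have -> : c * t%:R ^+ 2 / (delta * expR (c * z)) = c * t%:R ^+ 2 / delta * expR (- (c * z)).
  by rewrite invfM mulrA expRN.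
set B := c * t%:R ^+ 2 / delta * expR (- (c * z)).
have B0 : 0 <= B by rewrite !mulr_ge0 ?expR_ge0 ?sqr_ge0 ?invr_ge0 // ltW.
(* As P <= 1, P^2 <= P. *)
suff le : P <= B ^+ 2.
  by rewrite -ler_sqr ?nnegrE //; apply: le_trans le; rewrite expr2 ler_piMl.
apply: le_trans tail _.
have -> : B ^+ 2 = c ^+ 2 * t%:R ^+ 4 / delta ^+ 2 * expR (- (2 * (c * z))).
  rewrite /B exprMn -expRM_natl; congr (_ * expR _); last by ring.
  by field; rewrite lt0r_neq0.
rewrite ler_pM ?expR_ge0 ?mulr_ge0 ?invr_ge0 ?sqr_ge0 ?(ltW d0) //; try lra; last first.
  by rewrite ler_expR lerN2 mulrA mulrC ler_wpM2l.
have -> : c ^+ 2 * t%:R ^+ 4 / delta ^+ 2 = c ^+ 2 * t%:R ^+ 4 / delta / delta by field; rewrite lt0r_neq0.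
rewrite ler_pM2r ?invr_gt0 // ler_pdivlMr //.
(* The prefactor 8 l is absorbed by l <= l^2 <= c^2 t and by 8 <= t, which follows from 1 <= c^2 t
   with c small. *)
have le8 : 8 * l%:R <= 8 * c ^+ 2 * t%:R by nra.
have t8 : 8 <= t%:R :> R.
  have : 1 <= c ^+ 2 * t%:R by apply: le_trans lt; rewrite expr_ge1 //; lra.
  have : c ^+ 2 <= 1 / 8 by nra.
  by nra.
have : 8 * c ^+ 2 * t%:R <= c ^+ 2 * t%:R ^+ 2.
  have -> : 8 * c ^+ 2 * t%:R = c ^+ 2 * (8 * t%:R) by ring.
  by rewrite ler_wpM2l ?sqr_ge0 // [t%:R ^+ 2]expr2 ler_wpM2r // ltW.
move=> le8t; have {}le8 := le_trans le8 le8t.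
apply: (@le_trans _ _ (8 * l%:R * t%:R ^+ 2)).
  by rewrite ler_piMr ?(ltW d1) // !mulr_ge0 ?sqr_ge0.
have -> : c ^+ 2 * t%:R ^+ 4 = c ^+ 2 * t%:R ^+ 2 * t%:R ^+ 2 by ring.
by rewrite ler_wpM2r ?sqr_ge0.
Qed.
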